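(* Let $G$ be a finitely generated group and let $d(G)$ be the minimal number of generators of $G$. Let $S$ be a simplicial $G$–tree with finite quotient graph $\overline S=G\backslash S$ in which every edge stabilizer is finite. Then for any compressing forest $F$ of $\overline S$, $$\eta(S)=\sum_{e\in E\overline S\setminus EF}\frac{1}{|G(e)|}\le d(G),$$ where $G(e)$ is the stabilizer of a lift of $e$ to $S$.
   Context: For a simplicial $G$–tree $S$ with finite quotient graph $\overline S=G\backslash S$, denote by $G(v)$, $G(e)$ the stabilizers in $G$ of chosen lifts of a vertex $v$ or edge $e$ of $\overline S$ (compatible, so that for an edge from $\iota e$ to $\tau e$ its stabilizer is a subgroup of the stabilizers of the lifted endpoints). A compressing forest is a subgraph $F$ of $\overline S$ containing no cycle, with $VF=V\overline S$, whose edges are oriented so that each vertex has at most one edge of $F$ oriented away from it, such that every edge $e\in EF$ oriented from $\iota e$ to $\tau e$ satisfies $G(e)=G(\iota e)$ (for the lift of $e$ and its initial vertex), and which is maximal with respect to these properties. Collapsing the $G$–orbits of edges lying over $F$ yields a reduced $G$–tree $S^*$ whose quotient graph $\overline{S^*}$ has edge set $E\overline S\setminus EF$ with the same edge groups; thus $\eta(S)=\sum_{e\in E\overline{S^*}}1/|G(e)|$. *)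

(* Defs.v *)
From HB Require Import structures.
From mathcomp Require Import all_boot all_order all_algebra.
From Stdlib Require List.
Set Implicit Arguments. Unset Strict Implicit. Unset Printing Implicit Defensive.

Record group_on (G : Type) := GroupOn {
  gmul : G -> G -> G;
  gone : G;
  ginv : G -> G;
  gmulA : forall x y z, gmul x (gmul y z) = gmul (gmul x y) z;
  gmul1 : forall x, gmul gone x = x;
  gmulV : forall x, gmul (ginv x) x = gone }.

Inductive gen_by (G : Type) (grp : group_on G) (S : seq G) : G -> Prop :=
 | gen_in x : List.In x S -> gen_by grp S x
 | gen_one : gen_by grp S (gone grp)
 | gen_mul x y : gen_by grp S x -> gen_by grp S y -> gen_by grp S (gmul grp x y)
 | gen_inv x : gen_by grp S x -> gen_by grp S (ginv grp x).

Definition generates (G : Type) (grp : group_on G) (S : seq G) :=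
  forall g, gen_by grp S g.

Definition min_num_generators (G : Type) (grp : group_on G) (d : nat) :=
  (exists S : seq G, size S = d /\ generates grp S) /\
  (forall S : seq G, generates grp S -> (d <= size S)%N).

Definition has_card (T : Type) (P : T -> Prop) (n : nat) :=
  exists l : seq T, List.NoDup l /\ size l = n /\ (forall x, List.In x l <-> P x).

Section SerreGraph.
Variables (V E : Type) (src : E -> V) (rev : E -> E).
Definition tgt (e : E) : V := src (rev e).

Fixpoint walk (v : V) (es : seq E) (w : V) : Prop :=
  match es with
  | [::] => v = w
  | e :: es' => src e = v /\ walk (tgt e) es' w
  end.

Fixpoint reduced (es : seq E) : Prop :=
  match es with
  | e1 :: ((e2 :: _) as es') => e2 <> rev e1 /\ reduced es'
  | _ => True
  end.

Definition is_tree : Prop :=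
  (exists v : V, True) /\
  (forall v w, exists es, walk v es w) /\
  (forall v es, walk v es v -> reduced es -> es = [::]).
End SerreGraph.

Record Gtree (G : Type) (grp : group_on G) := MkGtree {
  vtx : Type;
  edg : Type;
  src : edg -> vtx;
  rev : edg -> edg;
  revK : forall e, rev (rev e) = e;
  rev_neq : forall e, rev e <> e;
  tree_ax : is_tree src rev;
  actv : G -> vtx -> vtx;
  acte : G -> edg -> edg;
  actv1 : forall v, actv (gone grp) v = v;
  actvM : forall g h v, actv (gmul grp g h) v = actv g (actv h v);
  acte1 : forall e, acte (gone grp) e = e;
  acteM : forall g h e, acte (gmul grp g h) e = acte g (acte h e);
  src_act : forall g e, src (acte g e) = actv g (src e);
  rev_act : forall g e, rev (acte g e) = acte g (rev e);
  no_inversion : forall g e, acte g e <> rev e }.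

Section Quotient.
Variables (G : Type) (grp : group_on G) (T : Gtree grp).

Definition stabV (v : vtx T) (g : G) : Prop := actv g v = v.
Definition stabE (e : edg T) (g : G) : Prop := acte g e = e.

(** Vb, Eb together with pV, pE form the quotient graph G\S:
    vertices = G-orbits of vertices, (geometric) edges = G-orbits of
    edges up to orientation. *)
Definition is_quotient (Vb Eb : Type) (pV : vtx T -> Vb) (pE : edg T -> Eb) :=
  (forall x : Vb, exists v, pV v = x) /\
  (forall v w, pV v = pV w <-> exists g, w = actv g v) /\
  (forall y : Eb, exists e, pE e = y) /\
  (forall e e', pE e = pE e' <->
       exists g, e' = acte g e \/ e' = acte g (rev e)).

Variables (Vb Eb : finType) (pV : vtx T -> Vb) (pE : edg T -> Eb).

Definition qjoins (e : Eb) (x y : Vb) : Prop :=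
  exists et, pE et = e /\ pV (src et) = x /\ pV (tgt (@src _ _ T) (@rev _ _ T) et) = y.

Fixpoint qwalk (x : Vb) (l : seq Eb) (y : Vb) : Prop :=
  match l with
  | [::] => x = y
  | e :: l' => exists z, qjoins e x z /\ qwalk z l' y
  end.

(** F (a set of edges of the quotient, with all vertices) contains a cycle *)
Definition has_cycle (F : {set Eb}) : Prop :=
  exists (x : Vb) (l : seq Eb),
    l <> [::] /\ uniq l /\ (forall e, e \in l -> e \in F) /\ qwalk x l x.

(** orientation of F given by a lift [dir e] of each edge e of F; e is
    oriented from pV (src (dir e)) to pV (tgt (dir e)). *)
Definition oriented_forest (F : {set Eb}) (dir : Eb -> edg T) : Prop :=
  ~ has_cycle F /\
  (forall e, e \in F -> pE (dir e) = e) /\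
  (forall e1 e2, e1 \in F -> e2 \in F ->
      pV (src (dir e1)) = pV (src (dir e2)) -> e1 = e2) /\
  (forall e, e \in F -> forall g, stabE (dir e) g <-> stabV (src (dir e)) g).

Definition compressing_forest (F : {set Eb}) : Prop :=
  (exists dir, oriented_forest F dir) /\
  (forall F' : {set Eb}, F \proper F' -> ~ exists dir, oriented_forest F' dir).
End Quotient.

(* Main.v *)
From HB Require Import structures.
Require Import Defs.
From mathcomp Require Import all_boot all_order all_algebra.
From mathcomp Require Import finmap boolp classical_sets functions cardinality fsbigop.
From mathcomp Require Import lra.
Import Order.TTheory GRing.Theory Num.Theory.
Set Implicit Arguments. Unset Strict Implicit. Unset Printing Implicit Defensive.
Local Open Scope classical_set_scope.
Local Open Scope ring_scope.

(* The idea is Stallings' proof of Grushko's theorem. Call a set of roots of a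
   G-graph an invariant set of vertices such that every vertex can be pushed to a
   root along edges whose stabilizer is that of their initial vertex, and let its
   excess be the sum of [1/|G(e)|] over the orbits of edges minus the sum of
   [1/|G(v)|] over the orbits of vertices that are not roots. The roots of a
   compressing forest [F] have as excess the sum over the edges outside [F], and
   by maximality this is the least excess of all sets of roots of the tree: a flow
   from a root of [F] to a root of another set never leaves the orbit of its
   component of [F], and ends at a vertex of the same weight.

   It remains to find roots of the tree of excess at most [d]. The Cayley graph
   on [d] generators, subdivided so as to map to the tree, has such roots. A fold
   of two edges admits roots that do not increase the excess, and it strictly
   decreases the sum over the orbits of edges. As the denominators of these sums
   are bounded, the folding stops, at a graph that is immersed in the tree and
   hence is the tree itself once it meets all its orbits of vertices. *)

(** * Sums and weights of subgroups *)

Lemma ler_sum_inj (R : numDomainType) (I J : finType) (P : pred I) (Q : pred J)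
    (f : I -> R) (g : J -> R) (h : I -> J) :
  {in P &, injective h} -> (forall i, P i -> Q (h i) /\ f i = g (h i)) ->
  (forall j, Q j -> 0 <= g j) -> \sum_(i | P i) f i <= \sum_(j | Q j) g j.
Proof.
move=> h_inj hPQ g0; pose A := [set i | P i]%SET.
have -> : \sum_(i | P i) f i = \sum_(j in [set h i | i in A]%SET) g j.
  rewrite big_imset /=; last by move=> i j; rewrite !inE; apply: h_inj.
  by rewrite big_set; apply: eq_bigr => i /hPQ [].
rewrite [leRHS](bigID (mem [set h i | i in A]%SET)) /=.
rewrite (eq_bigl (fun j => Q j && (j \in [set h i | i in A]%SET))) ?lerDl ?sumr_ge0 //.
  by move=> j /andP [/g0].
move=> j; apply/idP/andP => [jA|[] //]; split=> //.
by have /imsetP [i] := jA; rewrite inE => /hPQ [Qh _] ->.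
Qed.

(* An infinite set has weight 0, as [fset_set] sends it to the empty set. *)
Definition weight (T : choiceType) (A : set T) : rat := #|` fset_set A|%:R^-1.

Lemma weight_infinite (T : choiceType) (A : set T) : infinite_set A -> weight A = 0.
Proof. by rewrite /weight /fset_set; case: pselect; rewrite ?cardfs0 ?invr0. Qed.

Section Weight.
Variable T : choiceType.
Implicit Types A B : set T.

Lemma weight_card_eq (U : choiceType) A (B : set U) :
  (A #= B)%card -> weight A = weight B.
Proof.
move=> AB; have [finA|infA] := pselect (finite_set A); last first.
  by rewrite !weight_infinite // -(eq_finite_set AB).
have /finite_setP [n Bn] : finite_set B by rewrite -(eq_finite_set AB).
by rewrite /weight (card_fset_set (card_eq_trans AB Bn)) (card_fset_set Bn).
Qed.

Lemma weight_ge0 A : 0 <= weight A.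
Proof. by rewrite invr_ge0. Qed.

Lemma card_fset_set_gt0 A : A !=set0 -> finite_set A -> (0 < #|` fset_set A|)%N.
Proof.
by move=> [x Ax] finA; rewrite cardfs_gt0; apply/fset0Pn; exists x;
  rewrite in_fset_set // inE.
Qed.

Lemma weight_gt0 A : A !=set0 -> finite_set A -> 0 < weight A.
Proof. by move=> A0 finA; rewrite invr_gt0 ltr0n card_fset_set_gt0. Qed.

Lemma weight_le1 A : weight A <= 1.
Proof.
rewrite /weight; case: #|` _| => [|n]; first by rewrite invr0.
by rewrite invf_le1 ?ltr0n ?ler1n.
Qed.

Lemma weight_antitone A B : A !=set0 -> A `<=` B -> weight B <= weight A.
Proof.
move=> A0 AB; have [finB|/weight_infinite ->] := pselect (finite_set B); last first.
  exact: weight_ge0.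
have finA := sub_finite_set AB finB; have gt0A := card_fset_set_gt0 A0 finA.
have leAB : (#|` fset_set A| <= #|` fset_set B|)%N.
  by apply: fsubset_leq_card; rewrite -fset_set_sub.
by rewrite lef_pV2 ?ler_nat // posrE ltr0n // (leq_trans gt0A).
Qed.

Lemma weight_fact_nat A n :
  A !=set0 -> (A #<= `I_n)%card -> weight A * n`!%:R \is a Num.nat.
Proof.
move=> A0 leAn; have finA : finite_set A by apply/finite_set_leP; exists n.
rewrite mulrC; apply: Qnat_dvd; apply: dvdn_fact.
by rewrite card_fset_set_gt0 // geq_card_fset_set.
Qed.

End Weight.

Section Subgroup.
Variable G : groupType.
Implicit Types (A B : set G) (g h : G).

Definition subgroup A :=
  [/\ A 1%g, forall g h, A g -> A h -> A (g * h)%g & forall g, A g -> A g^-1%g].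

Lemma subgroup_nonempty A : subgroup A -> A !=set0.
Proof. by case=> A1 _ _; exists 1%g. Qed.

Lemma proper_subgroup_card A B : subgroup A -> subgroup B -> A `<=` B ->
  ~ B `<=` A -> finite_set B -> (2 * #|` fset_set A| <= #|` fset_set B|)%N.
Proof.
move=> [A1 AM AV] [B1 BM BV] AB /existsPNP [g Bg nAg] finB.
have finA := sub_finite_set AB finB; set gA := [set (g * h)%g | h in A].
have fingA : finite_set gA by apply: finite_image.
have cardgA : #|` fset_set gA| = #|` fset_set A|.
  by rewrite /gA fset_set_image // card_imfset //; apply: mulgI.
have disj : A `&` gA = set0.
  apply/seteqP; split=> // x [Ax [h Ah gh]]; apply: nAg.
  by rewrite -(mulgK h g) gh; apply: AM => //; apply: AV.
rewrite mul2n -addnn -{2}cardgA -cardfsUI -fset_setU // -fset_setI // disj fset_set0.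
rewrite cardfs0 addn0; apply: fsubset_leq_card; rewrite -fset_set_sub ?finite_setU //.
by move=> x [/AB //|[h /AB Bh <-]]; apply: BM.
Qed.

Lemma weight_proper_subgroup A B : subgroup A -> subgroup B -> A `<=` B ->
  ~ B `<=` A -> 2 * weight B <= weight A.
Proof.
move=> sA sB AB nBA.
have [finB|/weight_infinite ->] := pselect (finite_set B); last first.
  by rewrite mulr0 weight_ge0.
have gt0A := card_fset_set_gt0 (subgroup_nonempty sA) (sub_finite_set AB finB).
have gt0B := card_fset_set_gt0 (subgroup_nonempty sB) finB.
rewrite /weight ler_pdivrMr ?ltr0n // mulrC ler_pdivlMr ?ltr0n //.
by rewrite -natrM ler_nat proper_subgroup_card.
Qed.

Lemma weight_le_eq_subgroup A B : subgroup A -> subgroup B -> A `<=` B ->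
  finite_set A -> weight A <= weight B -> A = B.
Proof.
move=> sA sB AB finA leAB; apply/seteqP; split=> //; apply: contrapT => nBA.
have := weight_proper_subgroup sA sB AB nBA.
have := weight_gt0 (subgroup_nonempty sA) finA; lra.
Qed.

End Subgroup.

(** * Sets with a group action *)

HB.mixin Record isGSet (G : groupType) M := {
  act : G -> M -> M;
  act1 : forall x, act 1%g x = x;
  actM : forall g h x, act (g * h)%g x = act g (act h x) }.

#[short(type="gsetType")]
HB.structure Definition GSet (G : groupType) := {M of isGSet G M & Choice M}.

Section GSetTheory.
Variables (G : groupType) (M : gsetType G).
Implicit Types (g h : G) (x y z : M) (P : set M).

Definition stab x : set G := [set g | act g x = x].
Definition gorbit x : set M := range (act^~ x).
Definition ginvariant P := forall g x, P x -> P (act g x).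

Lemma actK g : cancel (act g) (act g^-1%g : M -> M).
Proof. by move=> x; rewrite -actM mulVg act1. Qed.

Lemma act_inj g : injective (act g : M -> M).
Proof. exact: can_inj (actK g). Qed.

Lemma subgroup_stab x : subgroup (stab x).
Proof.
split=> [|g h gx hx|g gx]; rewrite /stab /=; first exact: act1.
  by rewrite actM hx gx.
by rewrite -{1}gx actK.
Qed.

Lemma stab_nonempty x : stab x !=set0.
Proof. exact/subgroup_nonempty/subgroup_stab. Qed.

Lemma stab_act g x : stab (act g x) = [set h | stab x (h ^ g)%g].
Proof.
apply/seteqP; split=> h; rewrite /stab /= !actM => hx; last first.
  by apply: (@act_inj g^-1%g); rewrite hx actK.
by rewrite hx actK.
Qed.

Lemma weight_stab_act g x : weight (stab (act g x)) = weight (stab x).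
Proof.
apply: weight_card_eq.
have -> : stab (act g x) = [set (h ^ g^-1)%g | h in stab x].
  rewrite stab_act; apply/seteqP; split=> [h hx|_ [h hx <-]] /=.
    by exists (h ^ g)%g; rewrite ?conjgK.
  by rewrite conjgKV.
by apply: inj_card_eq => h k _ _; apply: conjg_inj.
Qed.

Lemma gorbit_refl x : gorbit x x.
Proof. by exists 1%g; rewrite ?act1. Qed.

Lemma gorbit_sym x y : gorbit x y -> gorbit y x.
Proof. by move=> [g _ <-]; exists g^-1%g; rewrite ?actK. Qed.

Lemma gorbit_trans x y z : gorbit x y -> gorbit y z -> gorbit x z.
Proof. by move=> [g _ <-] [h _ <-]; exists (h * g)%g; rewrite ?actM. Qed.

Lemma gorbit_act x g : gorbit x (act g x).
Proof. by exists g. Qed.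

Lemma eq_gorbit x y : gorbit x y -> gorbit x = gorbit y.
Proof.
move=> xy; apply/seteqP; split=> z; last exact: gorbit_trans.
exact/gorbit_trans/gorbit_sym.
Qed.

Lemma eq_gorbitP x y : gorbit x = gorbit y <-> gorbit x y.
Proof. by split=> [->|/eq_gorbit //]; apply: gorbit_refl. Qed.

Lemma weight_stab_gorbit x y : gorbit x y -> weight (stab y) = weight (stab x).
Proof. by move=> [g _ <-]; apply: weight_stab_act. Qed.

Lemma ginvariantE P g x : ginvariant P -> P (act g x) = P x.
Proof. by move=> iP; apply/propext; split=> [/(iP g^-1%g)|/iP]; rewrite ?actK. Qed.

Lemma ginvariant_gorbit x : ginvariant (gorbit x).
Proof. by move=> g y xy; apply: gorbit_trans xy (gorbit_act _ _). Qed.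

Lemma ginvariantU P Q : ginvariant P -> ginvariant Q -> ginvariant (P `|` Q).
Proof. by move=> iP iQ g x [/iP|/iQ]; [left|right]. Qed.

Lemma ginvariantD P Q : ginvariant P -> ginvariant Q -> ginvariant (P `\` Q).
Proof. by move=> iP iQ g x; rewrite /setD /= !ginvariantE. Qed.

End GSetTheory.

Definition onto (T U : Type) (f : T -> U) := forall y, exists x, f x = y.

Definition equivariant (G : groupType) (M M' : gsetType G) (f : M -> M') :=
  forall g, {morph f : x / act g x}.

Section Equivariant.
Variables (G : groupType) (M M' : gsetType G) (f : M -> M').
Hypothesis f_equi : equivariant f.
Implicit Types (x y : M) (P : set M).

Lemma sub_stab_equivariant x : stab x `<=` stab (f x).
Proof. by move=> g gx; rewrite /stab /= -f_equi gx. Qed.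

Lemma gorbit_equivariant x y : gorbit x y -> gorbit (f x) (f y).
Proof. by move=> [g _ <-]; exists g; rewrite ?f_equi. Qed.

Lemma image_gorbit x : f @` gorbit x = gorbit (f x).
Proof.
apply/seteqP; split=> [_ [y xy <-]|_ [g _ <-]]; first exact: gorbit_equivariant.
by exists (act g x); rewrite ?f_equi //; apply: gorbit_act.
Qed.

Lemma ginvariant_image P : ginvariant P -> ginvariant (f @` P).
Proof. by move=> iP g _ [x Px <-]; exists (act g x); [apply: iP|rewrite f_equi]. Qed.

End Equivariant.

(** * Sums over orbits *)

Section OrbitSum.
Variables (G : groupType) (M : gsetType G).
Implicit Types (x y : M) (P Q : set M).

Definition orbits P : set (set M) := @gorbit G M @` P.

Definition orbit_weight (O : set M) : rat := xget 0 [set weight (stab x) | x in O].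

(* The junk value of a sum with infinite support is 0: the finiteness of
   [orbits P] is always assumed. *)
Definition orbit_sum P : rat := \sum_(O \in orbits P) orbit_weight O.

Lemma orbit_weightE x : orbit_weight (gorbit x) = weight (stab x).
Proof.
apply: xget_unique => [|_ [y xy <-]]; last exact: weight_stab_gorbit.
by exists x => //; apply: gorbit_refl.
Qed.

Lemma orbitsD_gorbit P x : orbits (P `\` gorbit x) = orbits P `\ gorbit x.
Proof.
apply/seteqP; split=> [_ [y [Py nxy] <-]|_ [[y Py <-] nxy]].
  by split; [exists y|move=> /esym/eq_gorbitP].
by exists y => //; split=> // /eq_gorbit xy; apply: nxy.
Qed.

Lemma sub_finite_orbits P Q : P `<=` Q -> finite_set (orbits Q) -> finite_set (orbits P).
Proof. by move=> PQ; apply/sub_finite_set/image_subset. Qed.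

Lemma orbit_sumD1 P x : ginvariant P -> finite_set (orbits P) ->
  orbit_sum P =
    (if `[< P x >] then weight (stab x) else 0) + orbit_sum (P `\` gorbit x).
Proof.
move=> iP finP; case: asboolP => [Px|nPx].
  rewrite /orbit_sum (fsbigD1 (gorbit x)) ?orbit_weightE ?orbitsD_gorbit //.
  by exists x.
rewrite add0r; congr orbit_sum; apply/esym/setDidPl/seteqP; split=> // y [Py [g _ xy]].
by apply: nPx; rewrite -(ginvariantE g x iP) xy.
Qed.

Lemma orbit_sum_fact_nat P n :
  (forall x, P x -> stab x #<= `I_n)%card -> finite_set (orbits P) ->
  orbit_sum P * n`!%:R \is a Num.nat.
Proof.
move=> leP finP; rewrite /orbit_sum fsbig_finite // mulr_suml big_seq.
apply: rpred_sum => O; rewrite in_fset_set // inE => -[x Px <-].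
by rewrite orbit_weightE; apply: weight_fact_nat (stab_nonempty x) (leP x Px).
Qed.

End OrbitSum.

Lemma orbit_sum_image (G : groupType) (M M' : gsetType G) (f : M -> M') (P : set M) :
  equivariant f -> ginvariant P -> set_inj P f ->
  orbit_sum (f @` P) = orbit_sum P.
Proof.
move=> f_equi iP f_inj.
have stabf x : P x -> stab (f x) = stab x.
  move=> Px; apply/seteqP; split; last exact: sub_stab_equivariant.
  by move=> g; rewrite /stab /= -f_equi => /f_inj -> //; rewrite inE //; apply: iP.
have orbf : orbits (f @` P) = image (orbits P) (image^~ f).
  apply/seteqP; split=> [_ [_ [x Px <-] <-]|_ [_ [x Px <-] <-]].
    by exists (gorbit x); [exists x|rewrite image_gorbit].
  by exists (f x); [exists x|rewrite image_gorbit].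
rewrite /orbit_sum orbf fsbig_image; last first.
  move=> O O'; rewrite !inE => -[x Px <-] [y Py <-].
  rewrite !image_gorbit // => /eq_gorbitP [g _]; rewrite -f_equi => /f_inj.
  rewrite !inE => gxy; apply/eq_gorbit; rewrite -gxy //; first exact: gorbit_act.
  exact: iP.
apply: eq_fsbigr => O; rewrite inE => -[x Px <-].
by rewrite image_gorbit // !orbit_weightE stabf.
Qed.

Lemma finite_orbits_image (G : groupType) (M M' : gsetType G) (f : M -> M') (P : set M) :
  equivariant f -> finite_set (orbits P) -> finite_set (orbits (f @` P)).
Proof.
move=> f_equi /(finite_image (image^~ f)); apply: sub_finite_set.
by move=> _ [_ [x Px <-] <-]; exists (gorbit x); [exists x|rewrite image_gorbit].
Qed.

Lemma orbit_sum_finquotient (G : groupType) (M : gsetType G) (I : finType) (pi : M -> I)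
    (r : I -> M) (P : set M) :
  (forall x y, pi x = pi y <-> gorbit x y) -> cancel r pi -> ginvariant P ->
  orbit_sum P = \sum_(i | `[< P (r i) >]) weight (stab (r i)).
Proof.
move=> piE rK iP; have orb_r x : gorbit (r (pi x)) x by apply/piE; rewrite rK.
have -> : orbit_sum P = \sum_(i \in [set i | P (r i)]) orbit_weight (gorbit (r i)).
  rewrite -(fsbig_image _ (fun i => gorbit (r i))); last first.
    by move=> i j _ _ /eq_gorbitP/piE; rewrite !rK.
  congr (\sum_(O \in _) _); apply/seteqP.
  split=> [_ [x Px <-]|_ [i Pri <-]]; last by exists (r i).
  exists (pi x); last exact/eq_gorbit/orb_r.
  by rewrite /mkset; have [g _ <-] := gorbit_sym (orb_r x); apply: iP.
rewrite [RHS]bigfs ?index_enum_uniq // => [|i _]; last by rewrite mem_index_enum.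
rewrite (_ : [set` _] = [set i | P (r i)]).
  by apply: eq_fsbigr => i _; rewrite orbit_weightE.
by apply/seteqP; split=> i /asboolP.
Qed.

(** * Merging two points of a set with a group action *)

Section Merge.
Variables (G : groupType) (M : gsetType G).
Implicit Types (a c x y z : M) (g h k : G).

Definition invariant_equivalence (R : M -> M -> Prop) :=
  [/\ forall x, R x x, forall x y, R x y -> R y x,
      forall x y z, R x y -> R y z -> R x z &
      forall g x y, R x y -> R (act g x) (act g y)].

Definition merge_rel a c x y :=
  forall R, invariant_equivalence R -> R a c -> R x y.

Lemma invariant_equivalence_merge_rel a c : invariant_equivalence (merge_rel a c).
Proof.
split=> [x|x y xy|x y z xy yz|g x y xy] R equivR Rac; case: (equivR) => Rr Rs Rt Ra.
- exact: Rr.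
- exact/Rs/(xy R).
- exact: Rt (xy R equivR Rac) (yz R equivR Rac).
- exact/Ra/(xy R).
Qed.

Lemma merge_rel_glue a c : merge_rel a c a c.
Proof. by move=> R. Qed.

Lemma merge_rel_sym a c : merge_rel a c = merge_rel c a.
Proof.
apply/funext => x; apply/funext => y; apply/propext.
by split=> xy R equivR Rac; apply: xy => //; case: (equivR) => _ Rs _ _; apply: Rs.
Qed.

Lemma merge_rel_separates a c x y : merge_rel a c x y ->
  x = y \/ (gorbit a `|` gorbit c) x /\ (gorbit a `|` gorbit c) y.
Proof.
pose O := gorbit a `|` gorbit c.
move=> /(_ (fun u v => u = v \/ O u /\ O v)); apply; last first.
  by right; split; [left|right]; apply: gorbit_refl.
split=> [u|u v|u v w|g u v].
- by left.
- by case=> [->|[]]; [left|right].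
- by case=> [-> //|[Ou Ov]] [<-|[_ Ow]]; right.
- have iO : ginvariant O by apply: ginvariantU; apply: ginvariant_gorbit.
  by case=> [->|[Ou Ov]]; [left|right; split; apply: iO].
Qed.

(* Two points of the orbits of [a] and [c] are related when the elements of [G]
   that carry [a] or [c] to them lie in the same coset of [L]. *)
Lemma merge_rel_stab_sub a c (L : set G) g : subgroup L ->
  stab a `<=` L -> stab c `<=` L -> [set h | act h a = c] `<=` L ->
  merge_rel a c a (act g a) -> L g.
Proof.
move=> [L1 LM LV] aL cL acL.
pose over k x := x = act k a \/ x = act k c.
have over_coset k m x : over k x -> over m x -> L (k^-1 * m)%g.
  have actL u w v z : act u w = act v z -> act (u^-1 * v)%g z = w.
    by move=> uv; rewrite actM -uv actK.
  move=> [->|->] [|] /actL.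
  - exact: aL.
  - move=> /(congr1 (act (k^-1 * m)^-1%g)); rewrite actK => /esym/acL/LV.
    by rewrite invgK.
  - exact: acL.
  - exact: cL.
have over_act m k x : over k x -> over (m * k)%g (act m x).
  by move=> [->|->]; [left|right]; rewrite actM.
pose R x y := x = y \/ exists k h, [/\ L h, over k x & over (k * h)%g y].
have equivR : invariant_equivalence R.
  split=> [x|x y|x y z|m x y]; first by left.
  - case=> [->|[k [h [Lh kx ky]]]]; first by left.
    by right; exists (k * h)%g, h^-1%g; rewrite mulgK; split=> //; apply: LV.
  - case=> [-> //|[k [h [Lh kx ky]]]] [<-|[k' [h' [Lh' ky' kz]]]].
      by right; exists k, h.
    right; exists k, (h * (((k * h)^-1 * k') * h'))%g; split=> //.
      by apply: (LM _ _ Lh); apply: LM Lh'; apply: over_coset ky ky'.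
    by rewrite !mulgA mulgV mul1g.
  - case=> [->|[k [h [Lh kx ky]]]]; first by left.
    by right; exists (m * k)%g, h; rewrite -mulgA; split=> //; apply: over_act.
have Rac : R a c.
  by right; exists 1%g, 1%g; split; rewrite // ?mulg1; [left|right]; rewrite act1.
move=> /(_ R equivR Rac) [/esym/aL //|[k [h [Lh ka kga]]]].
have Lk : L k by rewrite -[k]mul1g -invg1; apply: over_coset ka; left; rewrite act1.
by rewrite -(mulVKg (k * h)%g g); apply: (LM _ _ (LM _ _ Lk Lh));
  apply: over_coset kga _; left.
Qed.

Section MergeQuotient.
Local Open Scope quotient_scope.
Variables a c : M.

Let merge_relb x y := `[< merge_rel a c x y >].

Lemma merge_relb_equiv : equiv_class_of merge_relb.
Proof.
have [Rr Rs Rt _] := invariant_equivalence_merge_rel a c.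
rewrite /merge_relb; split=> [x|x y|y x z]; first by apply/asboolP; apply: Rr.
  by apply: asbool_equiv_eq; split; apply: Rs.
by move=> /asboolP yx /asboolP xz; apply/asboolP; apply: Rt yx xz.
Qed.

Canonical merge_equiv_rel := EquivRelPack merge_relb_equiv.

Definition merge : Type := {eq_quot merge_equiv_rel}.
HB.instance Definition _ := Choice.on merge.

Definition merge_proj x : merge := \pi_{eq_quot merge_equiv_rel} x.

Lemma merge_proj_eq x y : merge_proj x = merge_proj y <-> merge_rel a c x y.
Proof. by split=> [/eqmodP/asboolP|xy]; last exact/eqmodP/asboolP. Qed.

Definition merge_act g (q : merge) : merge := merge_proj (act g (repr q)).

Lemma merge_act_proj g x : merge_act g (merge_proj x) = merge_proj (act g x).
Proof.
have [_ _ _ Ra] := invariant_equivalence_merge_rel a c.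
by apply/merge_proj_eq; apply: Ra; apply/merge_proj_eq; apply: reprK.
Qed.

Lemma merge_proj_onto : onto merge_proj.
Proof. by move=> q; exists (repr q); apply: reprK. Qed.

Lemma merge_act1 q : merge_act 1%g q = q.
Proof. by have [x <-] := merge_proj_onto q; rewrite merge_act_proj act1. Qed.

Lemma merge_actM g h q : merge_act (g * h)%g q = merge_act g (merge_act h q).
Proof. by have [x <-] := merge_proj_onto q; rewrite !merge_act_proj actM. Qed.

HB.instance Definition _ := isGSet.Build G merge merge_act1 merge_actM.

End MergeQuotient.

End Merge.

Record is_merge (G : groupType) (M M' : gsetType G) (p : M -> M') (a c : M) : Prop := {
  merge_equivariant : equivariant p;
  merge_onto : onto p;
  merge_eqP : forall x y, p x = p y <-> merge_rel a c x y }.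

Lemma is_merge_proj (G : groupType) (M : gsetType G) (a c : M) :
  is_merge (@merge_proj G M a c) a c.
Proof.
split; [|exact: merge_proj_onto|exact: merge_proj_eq].
by move=> g x; rewrite -merge_act_proj.
Qed.

(* The image of [P] under a map that merges [a] and [c], except that [flag] tells
   whether it contains the merged orbit. *)
Definition merge_set (G : groupType) (M M' : gsetType G) (p : M -> M') (a : M)
    (P : set M) (flag : bool) : set M' :=
  (if flag then gorbit (p a) else set0) `|` (p @` P `\` gorbit (p a)).

Lemma merge_rel_kernel (G : groupType) (M Z : gsetType G) (f : M -> Z) (a c x y : M) :
  equivariant f -> f a = f c -> merge_rel a c x y -> f x = f y.
Proof.
move=> f_equi fac xy; apply: (xy (fun x y => f x = f y)) => //.
by split=> [//|//|u v w -> //|g u v fuv]; rewrite !f_equi fuv.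
Qed.

Section IsMerge.
Variables (G : groupType) (M M' : gsetType G) (p : M -> M') (a c : M).
Hypothesis merge_p : is_merge p a c.
Implicit Types (x y : M) (P : set M) (flag : bool).

Lemma is_merge_sym : is_merge p c a.
Proof. by case: merge_p => p_equi p_onto p_eq; split=> // x y; rewrite merge_rel_sym. Qed.

Lemma merge_glue : p a = p c.
Proof. by apply/(merge_eqP merge_p); apply: merge_rel_glue. Qed.

Lemma merge_separates x y : p x = p y ->
  x = y \/ (gorbit a `|` gorbit c) x /\ (gorbit a `|` gorbit c) y.
Proof. by move/(merge_eqP merge_p)/merge_rel_separates. Qed.

Lemma merge_stab_sub (L : set G) : subgroup L -> stab a `<=` L -> stab c `<=` L ->
  [set g | act g a = c] `<=` L -> stab (p a) `<=` L.
Proof.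
move=> sL aL cL acL g; rewrite /stab /= -(merge_equivariant merge_p).
move=> /esym/(merge_eqP merge_p).
exact: merge_rel_stab_sub sL aL cL acL.
Qed.

Lemma merge_gorbit x : gorbit (p a) (p x) = (gorbit a `|` gorbit c) x.
Proof.
have p_equi := merge_equivariant merge_p; apply/propext; split=> [[g _]|[|]].
- by rewrite -p_equi => /merge_separates [<-|[] //]; left; apply: gorbit_act.
- exact: gorbit_equivariant.
- by rewrite merge_glue; apply: gorbit_equivariant.
Qed.

Lemma merge_stab_out x : ~ (gorbit a `|` gorbit c) x -> stab (p x) `<=` stab x.
Proof.
move=> nx g; rewrite /stab /= -(merge_equivariant merge_p).
by move=> /merge_separates [//|[_ /nx]].
Qed.

Lemma merge_setE P flag x : merge_set p a P flag (p x) =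
  if `[< (gorbit a `|` gorbit c) x >] then flag : Prop else P x.
Proof.
rewrite /merge_set -merge_gorbit; case: asboolP => ox; apply/propext.
  by split=> [[|[_ /(_ ox)//]]|flagT]; [case: (flag)|left; rewrite flagT].
split=> [[|[[y Py /merge_separates [<- //|[_]]]]]|Px].
- by case: (flag) => [/ox|].
- by rewrite -merge_gorbit => /ox.
- by right; split=> //; exists x.
Qed.

Lemma merge_setT : merge_set p a setT true = setT.
Proof.
apply/seteqP; split=> // y _; have [x <-] := merge_onto merge_p y.
by rewrite merge_setE; case: asboolP.
Qed.

Lemma ginvariant_merge_set P flag : ginvariant P -> ginvariant (merge_set p a P flag).
Proof.
move=> iP g y; have [x <-] := merge_onto merge_p y.
rewrite -(merge_equivariant merge_p) !merge_setE.
by rewrite !(ginvariantE g x) //; apply: ginvariantU; apply: ginvariant_gorbit.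
Qed.

Lemma finite_orbits_merge_set P flag :
  finite_set (orbits P) -> finite_set (orbits (merge_set p a P flag)).
Proof.
move=> finP; rewrite /orbits /merge_set image_setU finite_setU; split.
  case: (flag); last by rewrite image_set0.
  apply: sub_finite_set (finite_set1 (gorbit (p a))) => _ [y ya <-].
  exact/esym/eq_gorbit.
apply: sub_finite_set (finite_orbits_image (merge_equivariant merge_p) finP).
by apply: image_subset => y [].
Qed.

Lemma merge_setD_gorbit P flag : merge_set p a P flag `\` gorbit (p a) =
  p @` (P `\` gorbit a `\` gorbit c).
Proof.
apply/seteqP; split=> [y []|_ [x [[Px nax] ncx] <-]].
  have [x <-] := merge_onto merge_p y; rewrite merge_setE.
  rewrite merge_gorbit; case: asboolP => // nx Px _.
  by exists x => //; split; [split=> // ox|move=> ox]; apply: nx; [left|right].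
have nx : ~ (gorbit a `|` gorbit c) x by case.
by split; rewrite ?merge_setE ?merge_gorbit //; case: asboolP.
Qed.

Lemma orbit_sum_merge P flag : ginvariant P -> finite_set (orbits P) ->
  orbit_sum (merge_set p a P flag) + (if `[< P a >] then weight (stab a) else 0)
    + (if `[< P c /\ ~ gorbit a c >] then weight (stab c) else 0)
  = orbit_sum P + (if flag then weight (stab (p a)) else 0).
Proof.
move=> iP finP; have iPa := ginvariantD iP (ginvariant_gorbit (x := a)).
rewrite (orbit_sumD1 a iP finP) (orbit_sumD1 c iPa); last first.
  exact: sub_finite_orbits (@subDsetl _ _ _) finP.
have iP' := ginvariant_merge_set (flag := flag) iP.
have finP' := finite_orbits_merge_set flag finP.
rewrite (orbit_sumD1 (p a) iP' finP').
have -> : merge_set p a P flag (p a) = flag.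
  by rewrite merge_setE asboolT //; left; apply: gorbit_refl.
rewrite asboolb merge_setD_gorbit orbit_sum_image;
  [rewrite /setD /=; lra|exact: merge_equivariant merge_p| |].
  exact/ginvariantD/ginvariant_gorbit.
move=> x y; rewrite !inE => -[[_ nax] ncx] _ /merge_separates [//|[[]//]].
Qed.

Lemma finite_orbits_mergeT :
  finite_set (orbits [set: M]) -> finite_set (orbits [set: M']).
Proof. by rewrite -merge_setT; apply: finite_orbits_merge_set. Qed.

Lemma orbit_sum_mergeT : finite_set (orbits [set: M]) ->
  orbit_sum [set: M'] + weight (stab a)
    + (if `[< ~ gorbit a c >] then weight (stab c) else 0)
  = orbit_sum [set: M] + weight (stab (p a)).
Proof.
move=> finT; have iT : ginvariant [set: M] by [].
have := orbit_sum_merge true iT finT; rewrite merge_setT asboolT //.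
by rewrite (_ : (_ /\ _) = ~ gorbit a c) //; apply/propext; split=> [[]|].
Qed.

End IsMerge.

(** * Graphs with a group action *)

Section Walk.
Variables (V : Type) (E : eqType) (src : E -> V) (opp : E -> E).
Hypothesis oppK : involutive opp.
Implicit Types (u v w : V) (es fs : seq E).
Local Notation walk := (walk src opp).
Local Notation reduced := (reduced opp).

Lemma walk_cat u es v fs w : walk u es v -> walk v fs w -> walk u (es ++ fs) w.
Proof.
by elim: es u => [u /= -> //|e es IH u [eu esv] fsw]; split=> //; apply: IH.
Qed.

Lemma walk_rev u es v : walk u es v -> walk v (rev (map opp es)) u.
Proof.
elim: es u => [u /= -> //|e es IH u [eu /IH esv]].
by rewrite /= rev_cons -cats1; apply: walk_cat esv _; rewrite /= /tgt oppK.
Qed.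

Lemma reduced_behead e es : reduced (e :: es) -> reduced es.
Proof. by case: es => // f es []. Qed.

Lemma walk_reduce u es v : walk u es v ->
  exists fs, [/\ walk u fs v, reduced fs & {subset fs <= es}].
Proof.
elim: es u => [u /= ->|e es IH u [eu /IH [fs [fsv redfs fses]]]]; first by exists [::].
have [[gs fsE]|nbt] := pselect (exists gs, fs = opp e :: gs).
  rewrite {}fsE in fsv redfs fses; exists gs; split.
  - by case: fsv => _; rewrite /tgt oppK eu.
  - exact: reduced_behead redfs.
  - by move=> f fgs; rewrite inE fses ?orbT // inE fgs orbT.
exists (e :: fs); split=> //.
  case: fs redfs nbt {fsv fses} => // f fs redfs nbt; split=> // fe.
  by apply: nbt; exists fs; rewrite fe.
by move=> f; rewrite !inE => /orP [->//|/fses ->]; rewrite orbT.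
Qed.

End Walk.

Lemma walk_map (V V' E E' : Type) (src : E -> V) (opp : E -> E) (src' : E' -> V')
    (opp' : E' -> E') (fV : V -> V') (fE : E -> E') u es v :
  (forall e, fV (src e) = src' (fE e)) -> (forall e, fE (opp e) = opp' (fE e)) ->
  walk src opp u es v -> walk src' opp' (fV u) (map fE es) (fV v).
Proof.
move=> fsrc fopp; elim: es u => [u /= -> //|e es IH u [<- /IH]].
by rewrite /= /tgt !fsrc fopp.
Qed.

Lemma is_tree_bij (V E E' : Type) (src : E -> V) (opp : E -> E) (src' : E' -> V)
    (opp' : E' -> E') (f : E' -> E) :
  bijective f -> (forall e, src (f e) = src' e) -> (forall e, f (opp' e) = opp (f e)) ->
  is_tree src opp -> is_tree src' opp'.
Proof.
move=> [f' fK f'K] fsrc fopp [neV [conn acyc]]; split=> //; split=> [v w|v es esv redes].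
  have [es esw] := conn v w; exists (map f' es); apply: (walk_map (fV := id)) esw => e.
    by rewrite -fsrc f'K.
  by apply: (can_inj fK); rewrite fopp !f'K.
have fes0 : map f es = [::].
  apply: (acyc v); first by apply: (walk_map (fV := id)) esv => e; rewrite ?fsrc ?fopp.
  elim: es redes {esv} => // e [//|e' es] IH [ne redes]; split; last exact: IH.
  by rewrite -fopp => /(can_inj fK).
by case: es fes0 {esv redes}.
Qed.

(* The graphs carry an invariant orientation: [ends true e] is the origin of the
   arc [e] and [ends false e] its terminus. *)
Record ggraph (G : groupType) := GGraph {
  vert : gsetType G;
  arc : gsetType G;
  ends : bool -> arc -> vert;
  ends_equivariant : forall b, equivariant (ends b) }.

Section GGraph.
Variables (G : groupType) (X : ggraph G).
Implicit Types (x y : vert X) (e : arc X) (b : bool).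

Definition dart : Type := (bool * arc X)%type.
Definition dart_src (u : dart) : vert X := ends u.1 u.2.
Definition dart_rev (u : dart) : dart := (~~ u.1, u.2).

Definition gwalk x (us : seq (bool * arc X)) y := walk dart_src dart_rev x us y.
Definition gconnected := forall x y, exists us, gwalk x us y.
Definition gtree := is_tree dart_src dart_rev.

Lemma gtree_connected : gtree -> gconnected.
Proof. by case=> _ []. Qed.

Lemma dart_revK : involutive dart_rev.
Proof. by case=> b e; rewrite /dart_rev /= negbK. Qed.

Lemma gwalk_act g x us y : gwalk x us y ->
  gwalk (act g x) [seq (u.1, act g u.2) | u <- us] (act g y).
Proof. by apply: walk_map => // u; rewrite /dart_src ends_equivariant. Qed.

Lemma sub_stab_ends b e : stab e `<=` stab (ends b e).
Proof. exact: sub_stab_equivariant (ends_equivariant b) e. Qed.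

Lemma weight_ends_le b e : weight (stab (ends b e)) <= weight (stab e).
Proof. by apply: weight_antitone; [exact: stab_nonempty|exact: sub_stab_ends]. Qed.

Lemma weight_ends_half b e :
  ~ stab (ends b e) `<=` stab e -> 2 * weight (stab (ends b e)) <= weight (stab e).
Proof.
by apply: weight_proper_subgroup; [exact: subgroup_stab..|exact: sub_stab_ends].
Qed.

End GGraph.

Record gmor (G : groupType) (X Y : ggraph G) := GMor {
  mvert : vert X -> vert Y;
  marc : arc X -> arc Y;
  mvert_equivariant : equivariant mvert;
  marc_equivariant : equivariant marc;
  mvert_ends : forall b e, mvert (ends b e) = ends b (marc e) }.

Section GMor.
Variables (G : groupType) (X Y : ggraph G) (m : gmor X Y).

Definition mdart (u : bool * arc X) : bool * arc Y := (u.1, marc m u.2).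

Lemma gwalk_map x us y : gwalk x us y -> gwalk (mvert m x) (map mdart us) (mvert m y).
Proof. by apply: walk_map => // u; rewrite /dart_src mvert_ends. Qed.

Lemma sub_stab_marc e : stab e `<=` stab (marc m e).
Proof. exact: sub_stab_equivariant (@marc_equivariant _ _ _ m) e. Qed.

Lemma sub_stab_mvert x : stab x `<=` stab (mvert m x).
Proof. exact: sub_stab_equivariant (@mvert_equivariant _ _ _ m) x. Qed.

Lemma weight_marc_le e : weight (stab (marc m e)) <= weight (stab e).
Proof. by apply: weight_antitone; [exact: stab_nonempty|exact: sub_stab_marc]. Qed.

Lemma weight_marc_half e :
  ~ stab (marc m e) `<=` stab e -> 2 * weight (stab (marc m e)) <= weight (stab e).
Proof.
by apply: weight_proper_subgroup; [exact: subgroup_stab..|exact: sub_stab_marc].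
Qed.

End GMor.

Section Factor.
Variables (T U Z : Type) (p : T -> U).
Hypothesis p_onto : onto p.

Definition factor (f : T -> Z) (y : U) : Z := f (sval (cid (p_onto y))).

Lemma factorE (f : T -> Z) x : (forall x y, p x = p y -> f x = f y) ->
  factor f (p x) = f x.
Proof. by rewrite /factor => fp; case: cid => y yx; apply: fp. Qed.

End Factor.

Lemma factor_equivariant (G : groupType) (M M' Z : gsetType G) (p : M -> M')
    (p_onto : onto p) (f : M -> Z) :
  equivariant p -> equivariant f -> (forall x y, p x = p y -> f x = f y) ->
  equivariant (factor p_onto f).
Proof.
move=> p_equi f_equi fp g y; have [x <-] := p_onto y.
by rewrite -p_equi !factorE // f_equi.
Qed.

Section QuotientGraph.
Variables (G : groupType) (X : ggraph G) (V E : gsetType G).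
Variables (pV : vert X -> V) (pE : arc X -> E).
Hypotheses (pV_equi : equivariant pV) (pE_equi : equivariant pE).
Hypotheses (pV_onto : onto pV) (pE_onto : onto pE).
Hypothesis ends_compat : forall b e f, pE e = pE f -> pV (ends b e) = pV (ends b f).

Definition quotient_ends b : E -> V := factor pE_onto (pV \o ends b).

Lemma quotient_ends_equivariant b : equivariant (quotient_ends b).
Proof.
apply: factor_equivariant => // [g e|e f]; last exact: ends_compat.
by rewrite /= ends_equivariant pV_equi.
Qed.

Definition quotient_graph : ggraph G := GGraph quotient_ends_equivariant.

Lemma quotient_proj_ends b e : pV (ends b e) = @ends G quotient_graph b (pE e).
Proof. by rewrite /= /quotient_ends factorE //= => e' f'; apply: ends_compat. Qed.

Definition quotient_proj : gmor X quotient_graph :=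
  GMor (Y := quotient_graph) pV_equi pE_equi quotient_proj_ends.

Variables (Y : ggraph G) (m : gmor X Y).
Hypothesis mvert_compat : forall x y, pV x = pV y -> mvert m x = mvert m y.
Hypothesis marc_compat : forall e f, pE e = pE f -> marc m e = marc m f.

Lemma quotient_factor_ends b (s : arc quotient_graph) :
  factor pV_onto (mvert m) (ends b s) = ends b (factor pE_onto (marc m) s).
Proof.
have [e <-] := pE_onto s.
by rewrite -quotient_proj_ends !factorE // mvert_ends.
Qed.

Definition quotient_factor : gmor quotient_graph Y :=
  GMor (X := quotient_graph)
    (factor_equivariant pV_onto pV_equi (@mvert_equivariant _ _ _ m) mvert_compat)
    (factor_equivariant pE_onto pE_equi (@marc_equivariant _ _ _ m) marc_compat)
    quotient_factor_ends.

Lemma quotient_factor_proj x : mvert quotient_factor (mvert quotient_proj x) = mvert m x.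
Proof. exact: factorE. Qed.

End QuotientGraph.

(** * Flows to the roots *)

(* [N] is the set of vertices that are not roots. A vertex flows if it can be
   pushed to a root along arcs whose stabilizer is that of their initial vertex,
   as along the edges of a compressing forest. *)
Inductive flows (G : groupType) (X : ggraph G) (N : set (vert X)) : vert X -> Prop :=
 | flows_root x : ~ N x -> flows N x
 | flows_step b e : stab (ends b e) `<=` stab e ->
     flows N (ends (~~ b) e) -> flows N (ends b e).

Lemma ginvariant_flows (G : groupType) (X : ggraph G) (N : set (vert X)) :
  ginvariant N -> ginvariant (flows N).
Proof.
move=> iN g x; elim=> {x} [x nx|b e be _ IH].
  by apply: flows_root; rewrite ginvariantE.
rewrite -ends_equivariant; apply: flows_step; last by rewrite ends_equivariant.
by move=> h; rewrite ends_equivariant !stab_act; apply: be.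
Qed.

Section MergeFlows.
Variables (G : groupType) (X X' : ggraph G) (p : gmor X X') (a c : vert X).
Hypothesis merge_p : is_merge (mvert p) a c.
Variables (N : set (vert X)) (flag : bool).
Hypotheses (iN : ginvariant N) (flagN : flag -> N a /\ N c).

Let N' : set (vert X') := merge_set (mvert p) a N flag.

Let iN' : ginvariant N' := ginvariant_merge_set merge_p iN.

Lemma merge_set_root x : ~ N x -> ~ N' (mvert p x).
Proof.
rewrite /N' (merge_setE merge_p); case: asboolP => // -[] [g _ <-] nN /flagN [Na Nc];
  apply: nN; exact: iN.
Qed.

Lemma flows_merge_step b e : stab (mvert p (ends b e)) `<=` stab (ends b e) ->
  stab (ends b e) `<=` stab e ->
  flows N' (mvert p (ends (~~ b) e)) -> flows N' (mvert p (ends b e)).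
Proof.
rewrite !mvert_ends => pbe be flows_e; apply: flows_step => //.
by apply: subset_trans pbe _; apply: subset_trans be _; apply: sub_stab_marc.
Qed.

Lemma flows_merge : (forall x, flows N x) -> flows N' (mvert p a) -> forall y, flows N' y.
Proof.
move=> flN flows_a y; have [x <-] := merge_onto merge_p y.
elim: (flN x) => {x y} [x nx|b e be _ IH]; first exact/flows_root/merge_set_root.
have [|out] := pselect ((gorbit a `|` gorbit c) (ends b e)); last first.
  by apply: flows_merge_step => //; apply: merge_stab_out out.
by rewrite -(merge_gorbit merge_p) => -[g _ <-]; apply: ginvariant_flows.
Qed.

(* Follow the flow of [x] up to its last visit of the merged orbits. *)
Lemma flows_last_visit x : (forall e : arc X, finite_set (stab e)) -> flows N x ->
  flows N' (mvert p x) \/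
  exists b e, [/\ (gorbit a `|` gorbit c) (ends b e), stab (ends b e) `<=` stab e,
    flows N' (mvert p (ends (~~ b) e)) & weight (stab (ends b e)) <= weight (stab x)].
Proof.
move=> finE; elim=> {x} [x nx|b e be _ [IH|[b' [e' [o be' flows_e weight_le]]]]].
- by left; apply/flows_root/merge_set_root.
- have [o|out] := pselect ((gorbit a `|` gorbit c) (ends b e)).
    by right; exists b, e; split.
  by left; apply: flows_merge_step => //; apply: merge_stab_out out.
right; exists b', e'; split=> //; apply: le_trans weight_le _.
apply: weight_antitone; first exact: stab_nonempty.
exact: subset_trans be (@sub_stab_ends _ _ _ _).
Qed.

Lemma flows_merge_exit b e d : mvert p d = mvert p a ->
  stab (mvert p a) `<=` stab d -> gorbit d (ends b e) -> stab (ends b e) `<=` stab e ->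
  flows N' (mvert p (ends (~~ b) e)) -> flows N' (mvert p a).
Proof.
move=> da ad [k _ ke] be flows_e; rewrite -da -(ginvariantE k _ (ginvariant_flows iN')).
rewrite -mvert_equivariant ke; apply: flows_merge_step => // g.
by rewrite -ke mvert_equivariant !stab_act da; apply: ad.
Qed.

End MergeFlows.

(** * Folding two arcs *)

Record is_fold (G : groupType) (X X' : ggraph G) (p : gmor X X') (b : bool)
    (e f : arc X) : Prop := {
  fold_src : ends b e = ends b f;
  fold_vert : is_merge (mvert p) (ends (~~ b) e) (ends (~~ b) f);
  fold_arc : is_merge (marc p) e f }.

(* [flag] tells whether the merged vertices are still not roots after the fold;
   the inequality says that the sum of the weights of the arc orbits minus that of
   the non-root orbits does not increase. *)
Definition fold_admissible (G : groupType) (X X' : ggraph G) (p : gmor X X') (b : bool)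
    (e f : arc X) (N : set (vert X)) (flag : bool) : Prop :=
  let a := ends (~~ b) e in let c := ends (~~ b) f in
  [/\ flag -> N a /\ N c, flows (merge_set (mvert p) a N flag) (mvert p a) &
    weight (stab (marc p e)) + (if `[< N a >] then weight (stab a) else 0)
      + (if `[< N c /\ ~ gorbit a c >] then weight (stab c) else 0)
    <= weight (stab e) + (if `[< ~ gorbit e f >] then weight (stab f) else 0)
      + (if flag then weight (stab (mvert p a)) else 0)].

Lemma is_fold_sym (G : groupType) (X X' : ggraph G) (p : gmor X X') (b : bool)
    (e f : arc X) : is_fold p b e f -> is_fold p b f e.
Proof. by case=> ef mV mE; split=> //; apply: is_merge_sym. Qed.

Lemma fold_exists (G : groupType) (X Y : ggraph G) (m : gmor X Y) (b : bool)
    (e f : arc X) :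
  ends b e = ends b f -> marc m e = marc m f ->
  exists (X' : ggraph G) (p : gmor X X') (m' : gmor X' Y),
    is_fold p b e f /\ forall x, mvert m' (mvert p x) = mvert m x.
Proof.
move=> ef mef; set a := ends (~~ b) e; set c := ends (~~ b) f.
have [pV_equi pV_onto pV_eq] := is_merge_proj a c.
have [pE_equi pE_onto pE_eq] := is_merge_proj e f.
have ends_compat b' e' f' : merge_proj e f e' = merge_proj e f f' ->
    merge_proj a c (ends b' e') = merge_proj a c (ends b' f').
  move=> /pE_eq; apply: (merge_rel_kernel (f := merge_proj a c \o ends b')) => [g x|].
    by rewrite /= ends_equivariant pV_equi.
  have [->|->] : b' = b \/ b' = ~~ b by case: (b) b' => -[]; auto.
    by rewrite /= ef.
  by apply/pV_eq; apply: merge_rel_glue.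
have mV_compat x y : merge_proj a c x = merge_proj a c y -> mvert m x = mvert m y.
  move=> /pV_eq; apply: merge_rel_kernel; first exact: mvert_equivariant.
  by rewrite !mvert_ends mef.
have mE_compat e' f' : merge_proj e f e' = merge_proj e f f' -> marc m e' = marc m f'.
  by move=> /pE_eq; apply: merge_rel_kernel mef; apply: marc_equivariant.
exists (quotient_graph pV_equi pE_equi pE_onto ends_compat).
exists (quotient_proj pV_equi pE_equi pE_onto ends_compat).
exists (quotient_factor pV_equi pE_equi pV_onto pE_onto ends_compat mV_compat mE_compat).
by split; [split=> //; apply: is_merge_proj|exact: quotient_factor_proj].
Qed.

Section FoldWeights.
Variables (G : groupType) (X X' : ggraph G) (p : gmor X X') (b : bool) (e f : arc X).
Hypothesis fold_p : is_fold p b e f.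

Lemma fold_glue : marc p e = marc p f.
Proof. exact: merge_glue (fold_arc fold_p). Qed.

Lemma fold_stab_src : stab (marc p e) `<=` stab (ends b e).
Proof.
apply: (merge_stab_sub (fold_arc fold_p)); first exact: subgroup_stab.
- exact: sub_stab_ends.
- by rewrite (fold_src fold_p); apply: sub_stab_ends.
- by move=> g /= ge; rewrite /stab /= -ends_equivariant ge (fold_src fold_p).
Qed.

Lemma fold_weight_le :
  [/\ weight (stab (marc p e)) <= weight (stab e),
      weight (stab (marc p e)) <= weight (stab f),
      weight (stab (ends (~~ b) e)) <= weight (stab e) &
      weight (stab (ends (~~ b) f)) <= weight (stab f)].
Proof.
split; [| |exact: weight_ends_le|exact: weight_ends_le].
  exact: weight_marc_le.
by rewrite fold_glue; apply: weight_marc_le.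
Qed.

Lemma fold_stab_merged :
  stab (ends (~~ b) e) `<=` stab e -> stab (ends (~~ b) f) `<=` stab f ->
  (forall g, act g (ends (~~ b) e) = ends (~~ b) f -> act g e = f) ->
  stab (mvert p (ends (~~ b) e)) = stab (marc p e).
Proof.
move=> ae cf acef; apply/seteqP; split; last by rewrite mvert_ends; apply: sub_stab_ends.
apply: (merge_stab_sub (fold_vert fold_p)); first exact: subgroup_stab.
- exact: subset_trans ae (@sub_stab_marc _ _ _ _ _).
- by rewrite fold_glue; apply: subset_trans cf (@sub_stab_marc _ _ _ _ _).
- by move=> g /= /acef gef; rewrite /stab /= -marc_equivariant gef fold_glue.
Qed.

Lemma fold_stab_proper : e <> f -> gorbit e f -> ~ stab (marc p e) `<=` stab e.
Proof.
move=> ef [g _ gef] pe; apply: ef; rewrite -gef; symmetry; apply: pe.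
by rewrite /stab /= -marc_equivariant gef fold_glue.
Qed.

End FoldWeights.

Section FoldFlows.
Variables (G : groupType) (X X' : ggraph G) (p : gmor X X') (b : bool) (e f : arc X).
Hypothesis fold_p : is_fold p b e f.
Hypothesis finE : forall e : arc X, finite_set (stab e).
Variable N : set (vert X).
Hypotheses (iN : ginvariant N) (flN : forall x, flows N x).

Local Notation a := (ends (~~ b) e).
Local Notation c := (ends (~~ b) f).
Let merge_p : is_merge (mvert p) a c := fold_vert fold_p.

Lemma fold_flows_root : flows (merge_set (mvert p) a N false) (mvert p a).
Proof.
by apply: flows_root; rewrite (merge_setE merge_p) asboolT //; left; apply: gorbit_refl.
Qed.

Lemma fold_flows_exit flag d (h : arc X) b' e' : stab (mvert p a) = stab (marc p e) ->
  mvert p d = mvert p a -> d = ends (~~ b) h -> ends b h = ends b e ->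
  stab d `<=` stab h -> gorbit d (ends b' e') -> stab (ends b' e') `<=` stab e' ->
  flows (merge_set (mvert p) a N flag) (mvert p (ends (~~ b') e')) ->
  weight (stab (ends b' e')) <= weight (stab (ends b e)) ->
  flows (merge_set (mvert p) a N flag) (mvert p a).
Proof.
move=> pae pd dh hv d_h o be flows_e; rewrite (weight_stab_gorbit o) => weight_le.
apply: (flows_merge_exit merge_p iN pd _ o be flows_e); rewrite pae.
have hd : stab h `<=` stab d by rewrite dh; apply: sub_stab_ends.
have -> : stab d = stab (ends b e); last exact: fold_stab_src fold_p.
have <- : stab h = stab d by apply/seteqP.
apply: weight_le_eq_subgroup (finE h) _; try exact: subgroup_stab.
  by rewrite -hv; apply: sub_stab_ends.
by apply: le_trans weight_le; apply: weight_antitone; [apply: stab_nonempty|].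
Qed.

(* The merged vertex is pushed back along the folded arc, unless the flow of its
   origin returns to [a] or [c]; then the stabilizers of [e] or [f] and of its
   origin agree, and the merged vertex can leave as this flow does. *)
Lemma fold_flows_eq_stab : N a -> N c -> stab a `<=` stab e -> stab c `<=` stab f ->
  stab (mvert p a) = stab (marc p e) -> flows (merge_set (mvert p) a N true) (mvert p a).
Proof.
move=> Na Nc ae cf pae; have N_ac : true -> N a /\ N c by [].
have [flows_e|[b' [e' [[o|o] be flows_e weight_le]]]] :=
  flows_last_visit merge_p iN N_ac finE (flN (ends b e)).
- rewrite mvert_ends; apply: flows_step; last by rewrite negbK -mvert_ends.
  by rewrite -mvert_ends pae.
- exact: (fold_flows_exit (h := e) pae) o be flows_e weight_le.
- have [ca fe] := (esym (merge_glue merge_p), esym (fold_src fold_p)).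
  exact: (fold_flows_exit (h := f) pae ca) o be flows_e weight_le.
Qed.

(* [c] cannot flow into the orbit of [a], as the stabilizers of [a] and [c] would
   then agree. *)
Lemma fold_flows_mixed : N a -> N c -> ~ gorbit a c -> stab a `<=` stab e ->
  ~ stab c `<=` stab f -> stab (marc p e) `<=` stab f ->
  stab (mvert p a) = stab c /\ flows (merge_set (mvert p) a N true) (mvert p a).
Proof.
move=> Na Nc nac ae ncf pef; have N_ac : true -> N a /\ N c by [].
have a_f : stab a `<=` stab f.
  by apply: subset_trans ae _; apply: subset_trans pef; apply: sub_stab_marc.
have a_c : stab a `<=` stab c by apply: subset_trans a_f _; apply: sub_stab_ends.
have pac : stab (mvert p a) = stab c.
  apply/seteqP; split; last by rewrite (merge_glue merge_p); apply: sub_stab_mvert.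
  apply: (merge_stab_sub merge_p) => //; first exact: subgroup_stab.
  by move=> g /= gac; case: nac; exists g.
split=> //; have [|[b' [e' [[o|o] be flows_e weight_le]]]] :=
  flows_last_visit merge_p iN N_ac finE (flN c).
- by rewrite (merge_glue merge_p).
- case: ncf; suff <- : stab a = stab c by [].
  apply: weight_le_eq_subgroup a_c _ _; try exact: subgroup_stab.
    exact: sub_finite_set ae (finE e).
  by rewrite -(weight_stab_gorbit o).
- by apply: (flows_merge_exit merge_p iN (esym (merge_glue merge_p)) _ o be flows_e);
    rewrite pac.
Qed.

End FoldFlows.

Section FoldAdmissible.
Variables (G : groupType) (X X' : ggraph G) (p : gmor X X') (b : bool) (N : set (vert X)).
Hypothesis finE : forall e : arc X, finite_set (stab e).
Hypotheses (iN : ginvariant N) (flN : forall x, flows N x).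

Section FixedArcs.
Variables e f : arc X.
Hypothesis fold_p : is_fold p b e f.
Local Notation a := (ends (~~ b) e).
Local Notation c := (ends (~~ b) f).

Lemma fold_admissible_gorbit : e <> f -> gorbit e f ->
  exists flag, fold_admissible p b e f N flag.
Proof.
move=> ef oef; have pe2 := weight_marc_half (fold_stab_proper fold_p ef oef).
have [le_pe le_pf le_a le_c] := fold_weight_le fold_p.
have ac : gorbit a c := gorbit_equivariant (ends_equivariant (~~ b)) oef.
have e0 := weight_ge0 (stab e).
have [Na|nNa] := pselect (N a); last first.
  exists false; split=> //; first exact: fold_flows_root fold_p _.
  by rewrite !asboolF //; [lra|case].
have [ae|/weight_ends_half a2] := pselect (stab a `<=` stab e); last first.
  exists false; split=> //; first exact: fold_flows_root fold_p _.
  by rewrite (asboolT Na) !asboolF //; [lra|case].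
have Nc : N c by case: ac => k _ <-; apply: iN.
have [k _ kef] := oef; have kac : act k a = c by rewrite -kef ends_equivariant.
have cf : stab c `<=` stab f by rewrite -kac -kef !stab_act => g /ae.
have pae : stab (mvert p a) = stab (marc p e).
  apply: (fold_stab_merged fold_p) => // g gac.
  apply: (@act_inj _ _ k^-1%g); rewrite -kef actK -actM; apply: ae.
  by rewrite /stab /= actM gac -kac actK.
exists true; split=> //; first by apply: (fold_flows_eq_stab fold_p).
by rewrite (asboolT Na) pae !asboolF //; [lra|case].
Qed.

Lemma fold_admissible_not_both : ~ gorbit e f -> gorbit a c \/ ~ (N a /\ N c) ->
  fold_admissible p b e f N false.
Proof.
move=> nef not_both; split=> //; first exact: fold_flows_root fold_p _.
have [le_pe le_pf le_a le_c] := fold_weight_le fold_p.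
rewrite (asboolT nef); have a0 := weight_ge0 (stab a); have c0 := weight_ge0 (stab c).
by do 2![case: asboolP => ?]; [tauto|lra..].
Qed.

Lemma fold_admissible_eq_stab : N a -> N c -> ~ gorbit e f -> ~ gorbit a c ->
  stab a `<=` stab e -> stab c `<=` stab f -> fold_admissible p b e f N true.
Proof.
move=> Na Nc nef nac ae cf; have [le_pe le_pf le_a le_c] := fold_weight_le fold_p.
have pae : stab (mvert p a) = stab (marc p e).
  by apply: (fold_stab_merged fold_p) => // g gac; case: nac; exists g.
split=> //; first by apply: (fold_flows_eq_stab fold_p).
by rewrite pae !asboolT //; lra.
Qed.

Lemma fold_admissible_mixed : N a -> N c -> ~ gorbit e f -> ~ gorbit a c ->
  stab a `<=` stab e -> ~ stab c `<=` stab f ->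
  exists flag, fold_admissible p b e f N flag.
Proof.
move=> Na Nc nef nac ae cf; have [le_pe le_pf le_a le_c] := fold_weight_le fold_p.
have [pef|pf] := pselect (stab (marc p e) `<=` stab f).
  have [pac flows_e] := fold_flows_mixed fold_p finE iN flN Na Nc nac ae cf pef.
  by exists true; split=> //; rewrite pac !asboolT //; lra.
exists false; split=> //; first exact: fold_flows_root fold_p _.
have pf2 := @weight_marc_half _ _ _ p f; rewrite -(fold_glue fold_p) in pf2.
by have := pf2 pf; have := weight_ends_half cf; rewrite !asboolT //; lra.
Qed.

Lemma fold_admissible_neq_stab : N a -> N c -> ~ gorbit e f -> ~ gorbit a c ->
  ~ stab a `<=` stab e -> ~ stab c `<=` stab f -> fold_admissible p b e f N false.
Proof.
move=> Na Nc nef nac /weight_ends_half a2 /weight_ends_half c2.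
have [le_pe le_pf le_a le_c] := fold_weight_le fold_p.
split=> //; first exact: fold_flows_root fold_p _.
by rewrite !asboolT //; lra.
Qed.

End FixedArcs.

Lemma fold_admissible_sym e f flag : is_fold p b e f -> ~ gorbit e f ->
  ~ gorbit (ends (~~ b) e) (ends (~~ b) f) -> N (ends (~~ b) e) -> N (ends (~~ b) f) ->
  fold_admissible p b f e N flag -> fold_admissible p b e f N flag.
Proof.
move=> fold_p nef nac Na Nc [_ flows_e].
have nfe : ~ gorbit f e by move/gorbit_sym.
have nca : ~ gorbit (ends (~~ b) f) (ends (~~ b) e) by move/gorbit_sym.
rewrite /merge_set -(merge_glue (fold_vert fold_p)) in flows_e *.
rewrite -(fold_glue fold_p) !asboolT // => weights_le; split=> //.
by rewrite !asboolT //; lra.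
Qed.

Lemma exists_fold_admissible e f : is_fold p b e f -> e <> f ->
  exists flag, fold_admissible p b e f N flag.
Proof.
move=> fold_p ef; have [oef|nef] := pselect (gorbit e f).
  exact: fold_admissible_gorbit.
pose a := ends (~~ b) e; pose c := ends (~~ b) f.
have [not_both|] := pselect (gorbit a c \/ ~ (N a /\ N c)).
  by exists false; apply: fold_admissible_not_both.
move=> /not_orP [nac /contrapT [Na Nc]].
have [ae|ae] := pselect (stab a `<=` stab e);
  have [cf|cf] := pselect (stab c `<=` stab f).
- by exists true; apply: fold_admissible_eq_stab.
- exact: fold_admissible_mixed.
- have [nfe nca] : ~ gorbit f e /\ ~ gorbit c a by split=> /gorbit_sym.
  have [flag adm] := fold_admissible_mixed (is_fold_sym fold_p) Nc Na nfe nca cf ae.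
  by exists flag; apply: fold_admissible_sym adm.
- by exists false; apply: fold_admissible_neq_stab.
Qed.

End FoldAdmissible.

(** * Rooted graphs over a graph *)

Record rooted (G : groupType) (Y : ggraph G) := Rooted {
  rgraph :> ggraph G;
  rmap : gmor rgraph Y;
  nonroot : set (vert rgraph);
  ginvariant_nonroot : ginvariant nonroot;
  flows_nonroot : forall x, flows nonroot x;
  finite_arc_orbits : finite_set (orbits [set: arc rgraph]);
  finite_nonroot_orbits : finite_set (orbits nonroot) }.

Arguments nonroot {G Y} r _ : rename.
Arguments ginvariant_nonroot {G Y} r _ _ _ : rename.
Arguments flows_nonroot {G Y} r _ : rename.

Definition arc_sum (G : groupType) (X : ggraph G) : rat := orbit_sum [set: arc X].

Definition excess (G : groupType) (Y : ggraph G) (R : rooted Y) : rat :=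
  arc_sum R - orbit_sum (nonroot R).

Section Joined.
Variables (G : groupType) (X : ggraph G).
Implicit Types x y z : vert X.

Definition gjoined x y := exists us, gwalk x us y.

Lemma gjoined_refl x : gjoined x x.
Proof. by exists [::]. Qed.

Lemma gjoined_trans x y z : gjoined x y -> gjoined y z -> gjoined x z.
Proof. by move=> [us xy] [vs yz]; exists (us ++ vs); apply: walk_cat xy yz. Qed.

Lemma gjoined_sym x y : gjoined x y -> gjoined y x.
Proof. by move=> [us xy]; eexists; apply: walk_rev xy; apply: dart_revK. Qed.

Lemma gjoined_act g x y : gjoined x y -> gjoined (act g x) (act g y).
Proof. by move=> [us /(gwalk_act g) xy]; eexists; apply: xy. Qed.

Lemma gjoined_ends b (e : arc X) : gjoined (ends b e) (ends (~~ b) e).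
Proof. by exists [:: (b, e)]. Qed.

End Joined.

Lemma gjoined_map (G : groupType) (X Y : ggraph G) (m : gmor X Y) x y :
  gjoined x y -> gjoined (mvert m x) (mvert m y).
Proof. by move=> [us /(gwalk_map m) xy]; eexists; apply: xy. Qed.

Section Extension.
Variables (G : groupType) (Y : ggraph G).

Definition extension (R R' : rooted Y) (p : gmor R R') : Prop :=
  [/\ forall x, mvert (rmap R') (mvert p x) = mvert (rmap R) x,
      forall x, ~ nonroot R x -> ~ nonroot R' (mvert p x) &
      forall y, exists x, gjoined (mvert p x) y].

(* The paths in [R] from the root [x0] to its translates by [hs] make [R] a
   subdivided Cayley graph. *)
Definition marked (R : rooted Y) (x0 : vert R) (hs : seq G) (ys : seq (vert Y)) : Prop :=
  [/\ ~ nonroot R x0, forall x, exists g, gjoined (act g x0) x,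
      forall h, h \in hs -> gjoined x0 (act h x0) &
      forall y, y \in ys -> exists2 x, gjoined x0 x & mvert (rmap R) x = y].

Lemma marked_extension (R R' : rooted Y) (p : gmor R R') x0 hs ys :
  extension p -> marked x0 hs ys -> marked (mvert p x0) hs ys.
Proof.
move=> [pY p_root p_reach] [x0_root x0_span x0_hs x0_ys]; split.
- exact: p_root.
- move=> y; have [x xy] := p_reach y; have [g gx] := x0_span x.
  by exists g; rewrite -mvert_equivariant; apply: gjoined_trans xy; apply: gjoined_map.
- by move=> h /x0_hs x0h; rewrite -mvert_equivariant; apply: gjoined_map.
- move=> y /x0_ys [x x0x xy]; exists (mvert p x); first exact: gjoined_map.
  by rewrite pY.
Qed.

Definition generating (hs : seq G) :=
  forall K : set G, subgroup K -> (forall h, h \in hs -> K h) -> K = setT.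

Lemma marked_connected (R : rooted Y) (x0 : vert R) hs ys :
  generating hs -> marked x0 hs ys -> gconnected R.
Proof.
move=> gen [_ x0_span x0_hs _].
pose K := [set g | gjoined x0 (act g x0)].
have sK : subgroup K.
  split=> [|g h gK hK|g gK]; rewrite /K /=; first by rewrite act1; apply: gjoined_refl.
    by rewrite actM; apply: gjoined_trans gK _; apply: gjoined_act.
  by apply: gjoined_sym; rewrite -[X in gjoined _ X](actK g); apply: gjoined_act.
have x0_all x : gjoined x0 x.
  have [g gx] := x0_span x; apply: gjoined_trans gx.
  by have : K g by rewrite (gen K).
by move=> x y; apply: gjoined_trans (x0_all y); apply: gjoined_sym.
Qed.

End Extension.

(** * The three moves on rooted graphs: spikes, mergings and folds *)

Section Regular.
Variable G : groupType.

Definition regular : Type := G.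
HB.instance Definition _ := Choice.on regular.

Definition regular_act (g : G) (k : regular) : regular := (g * k)%g.

Lemma regular_act1 k : regular_act 1%g k = k.
Proof. exact: mul1g. Qed.

Lemma regular_actM g h k : regular_act (g * h)%g k = regular_act g (regular_act h k).
Proof. exact/esym/mulgA. Qed.

HB.instance Definition _ := isGSet.Build G regular regular_act1 regular_actM.

Definition regular1 : regular := 1%g.

Lemma regular_orbit (k : regular) : act k regular1 = k.
Proof. exact: mulg1. Qed.

End Regular.

Section Sum.
Variables (G : groupType) (M M' : gsetType G).

Definition sum_act (g : G) (z : M + M') : M + M' :=
  match z with inl x => inl (act g x) | inr y => inr (act g y) end.

Lemma sum_act1 z : sum_act 1%g z = z.
Proof. by case: z => z /=; rewrite act1. Qed.

Lemma sum_actM g h z : sum_act (g * h)%g z = sum_act g (sum_act h z).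
Proof. by case: z => z /=; rewrite actM. Qed.

HB.instance Definition _ := isGSet.Build G (M + M')%type sum_act1 sum_actM.

Lemma stab_inl (x : M) : stab (inl x : M + M') = stab x.
Proof. by apply/seteqP; split=> g; [case|move=> gx; congr inl]. Qed.

Lemma stab_inr (y : M') : stab (inr y : M + M') = stab y.
Proof. by apply/seteqP; split=> g; [case|move=> gy; congr inr]. Qed.

End Sum.

Section SumRegular.
Variables (G : groupType) (M : gsetType G).
Implicit Types P : set M.

Definition sum_regular P : set (M + regular G) :=
  fun z => if z is inl x then P x else True.

Lemma ginvariant_sum_regular P : ginvariant P -> ginvariant (sum_regular P).
Proof. by move=> iP g [x|//]; apply: (iP g x). Qed.

Lemma gorbit_inr (k : regular G) : gorbit (inr (regular1 G) : M + regular G) (inr k).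
Proof. by exists k => //; congr inr; apply: regular_orbit. Qed.

Lemma sum_regularD P : sum_regular P `\` gorbit (inr (regular1 G)) = inl @` P.
Proof.
apply/seteqP; split=> [[x|k] [Pz no]|_ [x Px <-]].
- by exists x.
- by case: no; apply: gorbit_inr.
- by split=> // -[].
Qed.

Lemma finite_orbits_sum_regular P :
  finite_set (orbits P) -> finite_set (orbits (sum_regular P)).
Proof.
move=> finP; pose inlM : M -> M + regular G := inl.
apply: (@sub_finite_set _ _ (gorbit (inr (regular1 G)) |` orbits (inlM @` P))).
  move=> _ [[x|k] Pz <-]; [right|left]; first by exists (inl x) => //; exists x.
  exact/esym/eq_gorbit/gorbit_inr.
by rewrite finite_setU; split; [|apply: finite_orbits_image].
Qed.

Lemma weight_stab_regular1 : weight (stab (regular1 G)) = 1.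
Proof.
have -> : stab (regular1 G) = [set 1%g].
  by apply/seteqP; split=> [g|_ ->]; rewrite /stab /= ?act1 // regular_orbit.
by rewrite /weight fset_set1 cardfs1 invr1.
Qed.

Lemma orbit_sum_regular P : ginvariant P -> finite_set (orbits P) ->
  orbit_sum (sum_regular P) = 1 + orbit_sum P.
Proof.
move=> iP finP; have finP' := finite_orbits_sum_regular finP.
rewrite (orbit_sumD1 (inr (regular1 G)) (ginvariant_sum_regular iP) finP') asboolT //.
rewrite stab_inr weight_stab_regular1 sum_regularD orbit_sum_image //.
by move=> x y _ _ [].
Qed.

End SumRegular.

(* The graph [X] with a free orbit of arcs attached, the arc [g] having its [b]-end at
   [g x] and its other end at a new vertex [g]. *)
Section Spike.
Variables (G : groupType) (X : ggraph G) (b : bool) (x : vert X).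

Definition spike_ends b' (s : arc X + regular G) : vert X + regular G :=
  match s with
  | inl e => inl (ends b' e)
  | inr k => if b' == b then inl (act k x) else inr k
  end.

Lemma spike_ends_equivariant b' : equivariant (spike_ends b').
Proof.
move=> g [e|k] /=; first by rewrite /act /= ends_equivariant.
by case: eqP => _ //; rewrite /act /= -actM.
Qed.

Definition spike : ggraph G := GGraph spike_ends_equivariant.

Definition spike_incl : gmor X spike :=
  GMor (X := X) (Y := spike) (mvert := inl) (marc := inl)
    (fun _ _ => erefl) (fun _ _ => erefl) (fun _ _ => erefl).

Lemma spike_flows (N : set (vert X)) :
  (forall z, flows N z) -> forall z, @flows G spike (sum_regular N) z.
Proof.
move=> flN; have fl_inl z : @flows G spike (sum_regular N) (inl z).
  elim: (flN z) => {z} [z nz|b' e be _ IH]; first exact: flows_root.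
  by apply: (@flows_step _ spike _ b' (inl e)) => //; rewrite /= !stab_inl.
case=> [z //|k]; have nb : (~~ b == b) = false by case: (b).
have -> : inr k = @ends G spike (~~ b) (inr k) by rewrite /= nb.
by apply: flows_step; rewrite /= ?nb ?stab_inr ?negbK ?eqxx.
Qed.

Variables (Y : ggraph G) (m : gmor X Y) (s : arc Y).
Hypothesis xs : mvert m x = ends b s.

Definition spike_vert (z : vert X + regular G) : vert Y :=
  match z with inl z => mvert m z | inr k => act (k : G) (ends (~~ b) s) end.

Definition spike_arc (z : arc X + regular G) : arc Y :=
  match z with inl e => marc m e | inr k => act (k : G) s end.

Lemma spike_vert_equivariant : equivariant spike_vert.
Proof. by move=> g [z|k] /=; rewrite ?mvert_equivariant // -actM. Qed.

Lemma spike_arc_equivariant : equivariant spike_arc.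
Proof. by move=> g [z|k] /=; rewrite ?marc_equivariant // -actM. Qed.

Lemma spike_vert_ends b' (z : arc spike) : spike_vert (ends b' z) = ends b' (spike_arc z).
Proof.
case: z => [e|k] /=; first exact: mvert_ends.
rewrite ends_equivariant; case: eqP => [->|/eqP nb] /=.
  by rewrite mvert_equivariant xs.
by have -> : b' = ~~ b by case: (b) b' nb => -[].
Qed.

Definition spike_map : gmor spike Y :=
  GMor (X := spike) spike_vert_equivariant spike_arc_equivariant spike_vert_ends.

End Spike.

Section Moves.
Variables (G : groupType) (Y : ggraph G).
Implicit Types R : rooted Y.

Lemma spike_rooted R b (x : vert R) (s : arc Y) : mvert (rmap R) x = ends b s ->
  exists (R' : rooted Y) (p : gmor R R') (x' : vert R'),
    [/\ extension p, excess R' <= excess R, gjoined (mvert p x) x' &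
        mvert (rmap R') x' = ends (~~ b) s].
Proof.
move=> xs; have finA := finite_arc_orbits R; have finN := finite_nonroot_orbits R.
have iN := ginvariant_nonroot R.
have sumT : sum_regular [set: arc R] = [set: arc (spike b x)].
  by apply/seteqP; split=> [z|[]].
have finA' : finite_set (orbits [set: arc (spike b x)]).
  by rewrite -sumT; apply: finite_orbits_sum_regular.
pose R' := Rooted (spike_map xs) (ginvariant_sum_regular iN)
  (spike_flows (flows_nonroot R)) finA' (finite_orbits_sum_regular finN).
exists R', (spike_incl b x), (inr (regular1 G)).
have spiked (k : G) : @gjoined G (spike b x) (inl (act k x)) (inr k).
  have := gjoined_ends b (inr k : arc (spike b x)); rewrite /= eqxx.
  by have -> : (~~ b == b) = false by case: (b).
split.
- split=> // -[z|k]; first by exists z; apply: gjoined_refl.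
  by exists (act (k : G) x); apply: spiked.
- rewrite /excess /arc_sum -sumT !orbit_sum_regular //; lra.
- by have := spiked 1%g; rewrite act1.
- by rewrite /= act1.
Qed.

Lemma merge_rooted R (x x' : vert R) :
  mvert (rmap R) x = mvert (rmap R) x' -> ~ nonroot R x' ->
  exists (R' : rooted Y) (p : gmor R R'),
    [/\ extension p, excess R' <= excess R + 1 & mvert p x = mvert p x'].
Proof.
move=> xx' x'_root; have merge_p := is_merge_proj x x'.
have [pV_equi pV_onto pV_eq] := merge_p.
have id_equi : equivariant (@id (arc R)) by [].
have id_onto : onto (@id (arc R)) by move=> e; exists e.
have ends_compat b (e f : arc R) : e = f ->
    merge_proj x x' (ends b e) = merge_proj x x' (ends b f) by move=> ->.
have mV_compat y z : merge_proj x x' y = merge_proj x x' z ->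
    mvert (rmap R) y = mvert (rmap R) z.
  by move=> /pV_eq; apply: merge_rel_kernel xx'; apply: mvert_equivariant.
have mE_compat (e f : arc R) : e = f -> marc (rmap R) e = marc (rmap R) f by move=> ->.
pose p := quotient_proj pV_equi id_equi id_onto ends_compat.
pose m := quotient_factor pV_equi id_equi pV_onto id_onto ends_compat mV_compat mE_compat.
have iN := ginvariant_nonroot R; have finN := finite_nonroot_orbits R.
have not_flag : false -> nonroot R x /\ nonroot R x' by [].
have flN' : forall z, flows (merge_set (mvert p) x (nonroot R) false) z.
  apply: (flows_merge (p := p) merge_p iN not_flag (flows_nonroot R)).
  by apply: flows_root; rewrite (merge_setE merge_p) asboolT //; left; apply: gorbit_refl.
exists (Rooted m (ginvariant_merge_set merge_p iN) flN' (finite_arc_orbits R)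
  (finite_orbits_merge_set merge_p false finN)), p; split.
- split=> [z|z|y]; first exact: quotient_factor_proj.
    exact: (merge_set_root (p := p) merge_p iN not_flag).
  by have [z <-] := pV_onto y; exists z; apply: gjoined_refl.
- have nx' : `[< nonroot R x' /\ ~ gorbit x x' >] = false by apply/asboolF; case.
  have := orbit_sum_merge merge_p false iN finN; have := weight_le1 (stab x).
  rewrite /excess /arc_sum /= nx'.
  by have := weight_ge0 (stab x); case: asboolP => _; lra.
- exact: (merge_glue merge_p).
Qed.

Hypothesis finY : forall s : arc Y, finite_set (stab s).

Lemma finite_stab_arc R (e : arc R) : finite_set (stab e).
Proof. exact: sub_finite_set (@sub_stab_marc _ _ _ _ _) (finY (marc (rmap R) e)). Qed.

Lemma fold_rooted R b (e f : arc R) : ends b e = ends b f ->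
  marc (rmap R) e = marc (rmap R) f -> e <> f ->
  exists (R' : rooted Y) (p : gmor R R'),
    [/\ onto (mvert p),
        forall x, mvert (rmap R') (mvert p x) = mvert (rmap R) x,
        arc_sum R' < arc_sum R & excess R' <= excess R].
Proof.
move=> ef mef nef; have [X' [p [m [fold_p p_over]]]] := fold_exists ef mef.
have finE := @finite_stab_arc R; have iN := ginvariant_nonroot R.
have finA := finite_arc_orbits R; have finN := finite_nonroot_orbits R.
have [flag [flagN flows_a weights_le]] :=
  exists_fold_admissible finE iN (flows_nonroot R) fold_p nef.
have mV := fold_vert fold_p; have mE := fold_arc fold_p.
have sumA : arc_sum X' + _ + _ = arc_sum R + _ := orbit_sum_mergeT mE finA.
have sumN := orbit_sum_merge mV flag iN finN.
exists (Rooted m (ginvariant_merge_set mV iN)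
  (flows_merge mV iN flagN (flows_nonroot R) flows_a) (finite_orbits_mergeT mE finA)
  (finite_orbits_merge_set mV flag finN)), p; split=> //; first exact: merge_onto mV.
  have e_gt0 := weight_gt0 (stab_nonempty e) (finE e).
  have f_gt0 := weight_gt0 (stab_nonempty f) (finE f).
  have le_pe := weight_marc_le p e.
  move: sumA; case: asboolP => [_|/contrapT oef] /=; first lra.
  by have := weight_marc_half (fold_stab_proper fold_p nef oef); lra.
by move: weights_le; rewrite /excess /=; lra.
Qed.

End Moves.

(** * Folding a Cayley graph onto a tree *)

Section Immersion.
Variables (G : groupType) (X Y : ggraph G) (m : gmor X Y).

Definition immersion :=
  forall b e f, ends b e = ends b f -> marc m e = marc m f -> e = f.

Hypotheses (imm : immersion) (connX : gconnected X) (treeY : gtree Y).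

Lemma reduced_immersion x us y :
  gwalk x us y -> reduced (@dart_rev G X) us ->
  reduced (@dart_rev G Y) (map (mdart m) us).
Proof.
elim: us x => [//|u [//|v us] IH] x [xu uv_y] [nvu red]; split; last exact: IH uv_y red.
case: uv_y => vu _; move: nvu vu {xu red IH}.
case: u v => [b e] [b' f] /= nvu vu [b'E mef].
apply: nvu; rewrite /dart_rev /= -b'E; congr pair; move: vu; rewrite b'E => vu.
exact: imm vu mef.
Qed.

Lemma immersion_mvert_inj : injective (mvert m).
Proof.
move=> x y xy; have [us xus] := connX x y.
have [vs [xvs red _]] := walk_reduce (@dart_revK G X) xus.
have [_ [_ acyc]] := treeY; have := reduced_immersion xvs red.
have := gwalk_map m xvs; rewrite -xy => /acyc nil_vs /nil_vs.
by case: vs xvs {red nil_vs}.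
Qed.

Lemma immersion_marc_inj : injective (marc m).
Proof.
move=> e f ef; apply: (imm (b := true)) => //.
by apply: immersion_mvert_inj; rewrite !mvert_ends ef.
Qed.

Hypothesis mvert_onto : onto (mvert m).

(* Otherwise [s] and the image of a path joining lifts of its ends form a
   circuit. *)
Lemma immersion_marc_onto : onto (marc m).
Proof.
move=> s; have [x xs] := mvert_onto (ends true s).
have [y ys] := mvert_onto (ends false s).
have [us yus] := connX y x.
have [vs [yvs red sub]] := walk_reduce (@dart_revK G Y) (gwalk_map m yus).
have [[ws vsE]|nback] := pselect (exists ws, vs = (false, s) :: ws).
  have /mapP [[b e] _ [_ ->]] : (false, s) \in map (mdart m) us.
    by apply: sub; rewrite vsE mem_head.
  by exists e.
have circ : gwalk (mvert m x) ((true, s) :: vs) (mvert m x).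
  by split; [exact: esym xs|rewrite /tgt /dart_src /= -ys].
have [_ [_ acyc]] := treeY.
suff /(acyc _ _ circ) : reduced (@dart_rev G Y) ((true, s) :: vs) by [].
case: vs red nback {yvs sub circ} => // v vs red nback; split=> // vE; apply: nback.
by exists vs; rewrite vE.
Qed.

Lemma flows_immersion (N : set (vert X)) x :
  flows N x -> flows (mvert m @` N) (mvert m x).
Proof.
have stab_m z : stab (mvert m z) `<=` stab z.
  by move=> g; rewrite /stab /= -mvert_equivariant => /immersion_mvert_inj.
elim=> {x} [x nx|b e be _ IH].
  by apply: flows_root => -[z Nz /immersion_mvert_inj zx]; rewrite zx in Nz.
rewrite mvert_ends; apply: flows_step; last by rewrite -mvert_ends.
by rewrite -mvert_ends => g /stab_m /be; apply: sub_stab_marc.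
Qed.

End Immersion.

Section VoidGSet.
Variable G : groupType.

Definition void_act (g : G) (z : void) : void := z.

HB.instance Definition _ := isGSet.Build G void (act := void_act) (fun _ => erefl)
  (fun _ _ _ => erefl).

Definition regular_graph : ggraph G :=
  GGraph (vert := regular G) (arc := void) (ends := fun _ z => match z with end)
    (fun _ _ z => match z with end).

Variables (Y : ggraph G) (y0 : vert Y).

Definition orbit_map : gmor regular_graph Y :=
  GMor (X := regular_graph) (mvert := fun k : regular G => act (k : G) y0)
    (marc := fun z => match z with end) (fun g k => actM g k y0)
    (fun _ z => match z with end) (fun _ z => match z with end).

Lemma marked_nil : exists (R : rooted Y) (x0 : vert R),
  [/\ marked x0 [::] [::], mvert (rmap R) x0 = y0 & excess R <= 0].
Proof.
have inv0 : ginvariant (set0 : set (vert regular_graph)) by [].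
have fl0 z : @flows G regular_graph set0 z by apply: flows_root.
have finA : finite_set (orbits [set: arc regular_graph]).
  by apply: sub_finite_set (finite_set0 _) => ? [[]].
have finN : finite_set (orbits (set0 : set (vert regular_graph))).
  by rewrite /orbits image_set0.
exists (Rooted orbit_map inv0 fl0 finA finN), (regular1 G); split.
- split=> // k; exists k; rewrite regular_orbit; exact: gjoined_refl.
- exact: act1.
- rewrite /excess /arc_sum /orbit_sum /orbits image_set0 fsbig_set0 subr0.
  by rewrite fsbig1 // => ? [[]].
Qed.

End VoidGSet.

Section TreeRooting.
Variables (G : groupType) (Y : ggraph G).
Hypothesis treeY : gtree Y.

Lemma marked_walk hs ys us (R : rooted Y) (x0 x : vert R) y :
  marked x0 hs ys -> gjoined x0 x -> gwalk (mvert (rmap R) x) us y ->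
  exists (R' : rooted Y) (x0' : vert R'),
    [/\ marked x0' hs (y :: ys), mvert (rmap R') x0' = mvert (rmap R) x0 &
        excess R' <= excess R].
Proof.
elim: us R x0 x => [|[b s] us IH] R x0 x mark x0x.
  move=> /= xy; exists R, x0; split=> //; case: mark => x0_root x0_span x0_hs x0_ys.
  by split=> // z; rewrite inE => /orP [/eqP ->|/x0_ys //]; exists x.
move=> [/esym xs usy]; have [R' [p [x' [ext excess_le xx' x's]]]] := spike_rooted xs.
have [p_over _ _] := ext.
have x0x' : gjoined (mvert p x0) x' by apply: gjoined_trans xx'; apply: gjoined_map.
rewrite -[tgt _ _ _]x's in usy.
have [R'' [x0'' [mark'' x0''E excess_le'']]] :=
  IH R' _ _ (marked_extension ext mark) x0x' usy.
exists R'', x0''; split=> //; first by rewrite x0''E p_over.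
exact: le_trans excess_le'' excess_le.
Qed.

Lemma marked_cons hs ys h (R : rooted Y) (x0 : vert R) : marked x0 hs ys ->
  exists (R' : rooted Y) (x0' : vert R'),
    [/\ marked x0' (h :: hs) ys, mvert (rmap R') x0' = mvert (rmap R) x0 &
        excess R' <= excess R + 1].
Proof.
pose y0 := mvert (rmap R) x0 => mark.
have [us hus] := gtree_connected treeY y0 (act h y0).
have [R' [x0' [[x0'_root x0'_span x0'_hs x0'_ys] x0'E excess_le]]] :=
  marked_walk mark (gjoined_refl x0) hus.
have [x x0'x xh] := x0'_ys _ (mem_head _ _).
have hroot : ~ nonroot R' (act h x0').
  by rewrite (ginvariantE h x0' (ginvariant_nonroot R')).
have [|R'' [p [ext excess_le' px]]] := merge_rooted (x := x) (x' := act h x0') _ hroot.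
  by rewrite xh mvert_equivariant x0'E.
have mark' : marked x0' hs ys.
  by split=> // y yys; apply: x0'_ys; rewrite inE yys orbT.
have [p_over _ _] := ext; have [? ? x0_hs ?] := marked_extension ext mark'.
exists R'', (mvert p x0'); split; [split=> // h'|by rewrite p_over|lra].
rewrite inE => /orP [/eqP ->|/x0_hs //].
by rewrite -mvert_equivariant -px; apply: gjoined_map.
Qed.

Lemma exists_marked hs ys y0 : exists (R : rooted Y) (x0 : vert R),
  [/\ marked x0 hs ys, mvert (rmap R) x0 = y0 & excess R <= (size hs)%:R].
Proof.
elim: hs => [|h hs [R [x0 [mark x0E excess_le]]]]; last first.
  have [R' [x0' [mark' x0'E excess_le']]] := marked_cons h mark.
  by exists R', x0'; split; rewrite // ?x0'E // -natr1; lra.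
elim: ys => [|y ys [R [x0 [mark x0E excess_le]]]]; first exact: marked_nil.
have [us usy] := gtree_connected treeY y0 y; rewrite -x0E in usy.
have [R' [x0' [mark' x0'E excess_le']]] := marked_walk mark (gjoined_refl x0) usy.
by exists R', x0'; split; rewrite ?x0'E //; lra.
Qed.

Variable n : nat.
Hypothesis leY : forall s : arc Y, (stab s #<= `I_n)%card.

Lemma arc_sum_fact_nat (R : rooted Y) : arc_sum R * n`!%:R \is a Num.nat.
Proof.
apply: orbit_sum_fact_nat (finite_arc_orbits R) => e _.
apply: card_le_trans (leY (marc (rmap R) e)).
by apply: subset_card_le; apply: sub_stab_marc.
Qed.

(* Each fold decreases the sum over the arc orbits, a multiple of [1 / n`!]. *)
Lemma exists_immersion (R : rooted Y) :
  gconnected R -> onto (mvert (rmap R)) ->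
  exists R' : rooted Y, [/\ immersion (rmap R'), gconnected R',
    onto (mvert (rmap R')) & excess R' <= excess R].
Proof.
have finY (s : arc Y) : finite_set (stab s) by apply/finite_set_leP; exists n; apply: leY.
have /natrP [k Rk] := arc_sum_fact_nat R; elim/ltn_ind: k R Rk => k IH R Rk connR ontoR.
have [imm|] := pselect (immersion (rmap R)); first by exists R.
move=> /existsNP [b /existsNP [e /existsNP [f /not_implyP [ef /not_implyP [mef nef]]]]].
have [R' [p [p_onto p_over arc_sum_lt excess_le]]] := fold_rooted finY ef mef nef.
have /natrP [k' R'k'] := arc_sum_fact_nat R'.
have [|||R'' [imm'' conn'' onto'' excess_le'']] := IH k' _ R' R'k'.
- by rewrite -(ltr_nat rat) -Rk -R'k' ltr_pM2r // ltr0n fact_gt0.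
- move=> x y; have [x0 <-] := p_onto x; have [y0 <-] := p_onto y.
  exact/gjoined_map/connR.
- by move=> y; have [x <-] := ontoR y; exists (mvert p x); rewrite p_over.
- by exists R''; split=> //; apply: le_trans excess_le'' excess_le.
Qed.

Lemma tree_rooting (hs : seq G) (ys : seq (vert Y)) :
  generating hs -> (forall y, exists2 y', y' \in ys & gorbit y' y) ->
  exists N : set (vert Y),
    [/\ ginvariant N, forall y, flows N y & arc_sum Y - orbit_sum N <= (size hs)%:R].
Proof.
move=> gen ysP; have [[y0 _] _] := treeY.
have [R0 [x0 [mark _ excess_le0]]] := exists_marked hs ys y0.
have [|R [imm connR ontoR excess_le]] := exists_immersion (marked_connected gen mark).
  move=> y; have [y' y'ys [g _ <-]] := ysP y; have [_ _ _ x0_ys] := mark.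
  by have [x _ <-] := x0_ys _ y'ys; exists (act g x); rewrite mvert_equivariant.
have injV := immersion_mvert_inj imm connR treeY.
have injE := immersion_marc_inj imm connR treeY.
have arcE : marc (rmap R) @` [set: arc R] = [set: arc Y].
  apply/seteqP; split=> // s _; have [e <-] := immersion_marc_onto connR treeY ontoR s.
  by exists e.
exists (mvert (rmap R) @` nonroot R); split.
- exact/ginvariant_image/ginvariant_nonroot/mvert_equivariant.
- move=> y; have [x <-] := ontoR y.
  exact/(flows_immersion imm connR treeY)/flows_nonroot.
have -> : arc_sum Y = arc_sum R.
  rewrite /arc_sum -arcE orbit_sum_image //; first exact: marc_equivariant.
  by move=> ? ? _ _; apply: injE.
rewrite orbit_sum_image; [exact: le_trans excess_le excess_le0|exact: mvert_equivariant| |].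
  exact: ginvariant_nonroot.
by move=> ? ? _ _; apply: injV.
Qed.

End TreeRooting.

(** * The graph of a tree with a group action *)

Lemma mem_In (T : eqType) (x : T) (s : seq T) : (x \in s) <-> List.In x s.
Proof.
elim: s => //= y s IH; rewrite inE -IH; split=> [/orP [/eqP ->|]|[->|->]]; auto.
  by rewrite eqxx.
by rewrite orbT.
Qed.

Lemma NoDup_uniq (T : eqType) (s : seq T) : List.NoDup s -> uniq s.
Proof. by elim=> //= x {}s xs _ ->; rewrite andbT; apply/negP => /mem_In. Qed.

Lemma has_card_card_eq (T : choiceType) (P : set T) n : has_card P n -> (P #= `I_n)%card.
Proof.
move=> [s [/NoDup_uniq uniq_s [<- sP]]].
have -> : P = [set` seq_fset tt s].
  by apply/predeqP => x; rewrite /mkset seq_fsetE mem_In sP.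
by apply/card_eq_fsetP; rewrite size_seq_fset undup_id.
Qed.

Definition group_carrier (G : Type) (grp : group_on G) : Type := G.

Section GroupCarrier.
Variables (G : Type) (grp : group_on G).
Implicit Types x : G.

Lemma gmulVr x : gmul grp x (ginv grp x) = gone grp.
Proof.
rewrite -[LHS](gmul1 grp) -{1}(gmulV grp (ginv grp x)) -gmulA (gmulA grp (ginv grp x)).
by rewrite gmulV gmul1 gmulV.
Qed.

Lemma gmul1r x : gmul grp x (gone grp) = x.
Proof. by rewrite -(gmulV grp x) gmulA gmulVr gmul1. Qed.

HB.instance Definition _ := gen_eqMixin (group_carrier grp).
HB.instance Definition _ := gen_choiceMixin (group_carrier grp).
HB.instance Definition _ := isGroup.Build (group_carrier grp)
  (gmulA grp) (gmul1 grp) gmul1r (gmulV grp) gmulVr.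

Lemma generates_generating (S : seq (group_carrier grp)) :
  generates grp S -> generating S.
Proof.
move=> gen K [K1 KM KV] SK; apply/seteqP; split=> // g _.
elim: (gen g) => {g} [g gS||g h _ Kg _ Kh|g _ Kg]; [|exact: K1|exact: KM|exact: KV].
exact/SK/mem_In.
Qed.

End GroupCarrier.

Section TreeGraph.
Variables (G : Type) (grp : group_on G) (T : Gtree grp).
Local Notation gT := (group_carrier grp).

Definition tree_vert : Type := {classic (vtx T)}.
HB.instance Definition _ := Choice.on tree_vert.
HB.instance Definition _ := isGSet.Build gT tree_vert (@actv1 _ _ T) (@actvM _ _ T).

Definition tree_edge : Type := {classic (edg T)}.
HB.instance Definition _ := Choice.on tree_edge.
HB.instance Definition _ := isGSet.Build gT tree_edge (@acte1 _ _ T) (@acteM _ _ T).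

Definition tree_src : tree_edge -> tree_vert := @src _ _ T.
Definition tree_opp : tree_edge -> tree_edge := @Defs.rev _ _ T.

Lemma tree_src_equivariant : equivariant tree_src.
Proof. exact: src_act. Qed.

Lemma tree_opp_equivariant : equivariant tree_opp.
Proof. by move=> g e; apply: rev_act. Qed.

Lemma tree_oppK : involutive tree_opp.
Proof. exact: Defs.revK. Qed.

Lemma gorbit_src e f : gorbit e f -> gorbit (tree_src e) (tree_src f).
Proof. exact: (gorbit_equivariant tree_src_equivariant). Qed.

Lemma gorbit_opp e f : gorbit e f -> gorbit (tree_opp e) (tree_opp f).
Proof. exact: (gorbit_equivariant tree_opp_equivariant). Qed.

Lemma gorbit_oppl e f : gorbit (tree_opp e) f -> gorbit e (tree_opp f).
Proof. by move/gorbit_opp; rewrite tree_oppK. Qed.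

Lemma sub_stab_src e : stab e `<=` stab (tree_src e).
Proof. exact: (sub_stab_equivariant tree_src_equivariant). Qed.

Lemma stab_tree_opp e : stab (tree_opp e) = stab e.
Proof.
have sub_opp e' : stab e' `<=` stab (tree_opp e').
  exact: (sub_stab_equivariant tree_opp_equivariant).
by apply/seteqP; split=> //; rewrite -{2}(tree_oppK e).
Qed.

Lemma gorbit_tree_opp (e : tree_edge) : gorbit e <> gorbit (tree_opp e).
Proof. by move/eq_gorbitP => -[g _]; apply: no_inversion. Qed.

(* A choice between the two orbits of edges [gorbit e] and [gorbit (tree_opp e)],
   which are distinct as there is no inversion. *)
Definition positive (e : tree_edge) : bool :=
  xget set0 [set gorbit e; gorbit (tree_opp e)] == gorbit e.

Lemma positive_act g e : positive (act g e) = positive e.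
Proof.
have orb_act e' : gorbit (act g e') = gorbit e' by apply/esym/eq_gorbit/gorbit_act.
by rewrite /positive tree_opp_equivariant !orb_act.
Qed.

Lemma positive_opp e : positive (tree_opp e) = ~~ positive e.
Proof.
rewrite /positive tree_oppK setUC.
set P := [set gorbit e; gorbit (tree_opp e)]; have : P (xget set0 P).
  by apply: xgetPex; exists (gorbit e); left.
case=> ->; rewrite eqxx; first by apply/negbTE/eqP/gorbit_tree_opp.
by symmetry; apply/eqP => /esym; apply: gorbit_tree_opp.
Qed.

Definition positive_edge : Type := {e : tree_edge | positive e}.
HB.instance Definition _ := Choice.on positive_edge.

Definition positive_edge_act (g : gT) (s : positive_edge) : positive_edge :=
  exist _ (act g (val s)) (etrans (positive_act g (val s)) (valP s)).

Lemma positive_edge_act1 s : positive_edge_act 1%g s = s.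
Proof. by apply: val_inj; rewrite /= act1. Qed.

Lemma positive_edge_actM g h s :
  positive_edge_act (g * h)%g s = positive_edge_act g (positive_edge_act h s).
Proof. by apply: val_inj; rewrite /= actM. Qed.

HB.instance Definition _ :=
  isGSet.Build gT positive_edge positive_edge_act1 positive_edge_actM.

Definition dart_edge (u : bool * positive_edge) : tree_edge :=
  if u.1 then val u.2 else tree_opp (val u.2).

Lemma dart_edge_opp u : dart_edge (~~ u.1, u.2) = tree_opp (dart_edge u).
Proof. by case: u => -[] s; rewrite /dart_edge /= ?tree_oppK. Qed.

Lemma stab_dart_edge u : stab (dart_edge u) = stab u.2.
Proof.
have -> : stab u.2 = stab (val u.2) :> set gT.
  by apply/seteqP; split=> g gu; [rewrite /stab /= -[in RHS]gu|apply: val_inj].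
by rewrite /dart_edge; case: u.1; rewrite ?stab_tree_opp.
Qed.

Lemma dart_edge_bij : bijective dart_edge.
Proof.
pose sign e : bool * tree_edge := if positive e then (true, e) else (false, tree_opp e).
have sign_pos e : positive (sign e).2.
  by rewrite /sign; case: ifP => //= pe; rewrite positive_opp pe.
exists (fun e => ((sign e).1, exist _ (sign e).2 (sign_pos e))) => [[b s]|e].
  have sE : sign (dart_edge (b, s)) = (b, val s).
    by rewrite /sign /dart_edge; case: b; rewrite /= ?positive_opp (valP s) ?tree_oppK.
  by congr pair; [rewrite sE|apply: val_inj; rewrite /= sE].
by rewrite /dart_edge /= /sign; case: (positive e) => //=; apply: tree_oppK.
Qed.

Definition tree_ends b (s : positive_edge) : tree_vert := tree_src (dart_edge (b, s)).

Lemma tree_ends_equivariant b : equivariant (tree_ends b).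
Proof.
move=> g s; rewrite /tree_ends -tree_src_equivariant; congr tree_src.
by case: b => //=; rewrite /dart_edge /= -tree_opp_equivariant.
Qed.

Definition tree_graph : ggraph gT := GGraph tree_ends_equivariant.

Lemma gtree_tree_graph : gtree tree_graph.
Proof.
apply: is_tree_bij dart_edge_bij _ _ (tree_ax T) => [[b s] //|u].
exact: dart_edge_opp.
Qed.

End TreeGraph.

(** * Forests in the quotient graph *)

Section QuotientWalk.
Variables (G : Type) (grp : group_on G) (T : Gtree grp).
Variables (Vb Eb : finType) (pV : vtx T -> Vb) (pE : edg T -> Eb).
Implicit Types (x y z : Vb) (e : Eb) (F : {set Eb}) (es fs : seq Eb).

Lemma qwalk_cat x es y fs z : qwalk pV pE x es y -> qwalk pV pE y fs z ->
  qwalk pV pE x (es ++ fs) z.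
Proof.
elim: es x => [x /= -> //|e es IH x [w [xw esy]] fsz].
by exists w; split=> //; apply: IH.
Qed.

Lemma qwalk_split x es e fs z : qwalk pV pE x (es ++ e :: fs) z ->
  exists y y', [/\ qwalk pV pE x es y, qjoins pV pE e y y' & qwalk pV pE y' fs z].
Proof.
elim: es x => [x [y' [xy' y'z]]|f es IH x [w [xw /IH [y [y' [wy yy' y'z]]]]]].
  by exists x, y'.
by exists y, y'; split=> //; exists w.
Qed.

Lemma has_cycle_setU1 e F : has_cycle pV pE (e |: F) ->
  has_cycle pV pE F \/ exists x y es,
    [/\ qjoins pV pE e x y, qwalk pV pE y es x & {subset es <= F}].
Proof.
move=> [z [es [es0 [uniq_es [esF zz]]]]].
have inF f : f \in es -> f != e -> f \in F.
  by move=> /esF; rewrite !inE => /orP [->|].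
have [ee|nee] := boolP (e \in es); last first.
  left; exists z, es; split=> //; split=> //; split=> // f fes.
  by apply: inF => //; apply: contraNneq nee => <-.
right; case/splitPr: ee uniq_es inF zz => es1 es2; rewrite cat_uniq /= negb_or.
move=> /and3P [_ /andP [ne1 _] /andP [ne2 _]] inF /qwalk_split [x [y [zx xy yz]]].
exists x, y, (es2 ++ es1); split=> // [|f]; first exact: qwalk_cat yz zx.
rewrite mem_cat => fes; apply: inF.
  by rewrite mem_cat inE; case/orP: fes => ->; rewrite ?orbT.
by apply: contraTneq fes => ->; rewrite negb_or ne2 ne1.
Qed.

Section Trail.
Variables (F : {set Eb}) (x : nat -> Vb) (e : nat -> Eb).
Hypothesis joins : forall k, qjoins pV pE (e k) (x k) (x k.+1).
Hypothesis eF : forall k, e k \in F.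
Hypothesis e_x : forall k l, e k = e l -> x k = x l.

Lemma qwalk_trail i n : qwalk pV pE (x i) [seq e k | k <- iota i n] (x (i + n)%N).
Proof.
elim: n i => [|n IH] i /=; first by rewrite addn0.
by exists (x i.+1); split=> //; rewrite addnS -addSn.
Qed.

(* A circuit that repeats an edge contains a shorter one. *)
Lemma closed_trail_has_cycle i n : (0 < n)%N -> x i = x (i + n)%N -> has_cycle pV pE F.
Proof.
elim/ltn_ind: n i => n IH i n0 xin.
have [uniq_e|] := boolP (uniq [seq e k | k <- iota i n]).
  exists (x i), [seq e k | k <- iota i n]; split; first by case: (n) n0.
  split=> //; split; first by move=> _ /mapP [k _ ->].
  by rewrite {2}xin; apply: qwalk_trail.
move=> /(uniqPn (e 0%N)) [j [k [jk]]]; rewrite size_map size_iota => kn.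
rewrite !(nth_map 0%N) ?size_iota ?(ltn_trans jk kn) // !nth_iota ?(ltn_trans jk kn) //.
move=> /e_x xjk; apply: (IH (k - j)%N _ (i + j)%N); rewrite ?subn_gt0 //.
  exact: leq_ltn_trans (leq_subr _ _) kn.
by rewrite -addnA subnKC // ltnW.
Qed.

Lemma infinite_trail_has_cycle : has_cycle pV pE F.
Proof.
have [i [k [ik kV xik]]] : exists i k, [/\ (i < k)%N, (k < #|Vb|.+1)%N & x i = x k].
  have : ~~ uniq [seq x k | k <- iota 0 #|Vb|.+1].
    apply: contraL (max_card [in [seq x k | k <- iota 0 #|Vb|.+1]]) => /card_uniqP ->.
    by rewrite size_map size_iota ltnn.
  move=> /(uniqPn (x 0%N)) [i [k [ik]]]; rewrite size_map size_iota => kV.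
  rewrite !(nth_map 0%N) ?size_iota ?(ltn_trans ik kV) //.
  by rewrite !nth_iota ?(ltn_trans ik kV) // !add0n; exists i, k.
by apply: (@closed_trail_has_cycle i (k - i)%N); rewrite ?subn_gt0 // subnKC // ltnW.
Qed.

End Trail.

End QuotientWalk.

Section Forest.
Variables (G : Type) (grp : group_on G) (T : Gtree grp).
Variables (Vb Eb : finType) (pV : vtx T -> Vb) (pE : edg T -> Eb).
Hypothesis quotT : is_quotient pV pE.
Local Notation V := (tree_vert T).
Local Notation E := (tree_edge T).
Local Notation src := (@tree_src _ _ T).
Local Notation opp := (@tree_opp _ _ T).
Implicit Types (v w : V) (s : E).

Lemma pV_eq v w : pV v = pV w <-> gorbit v w.
Proof.
by case: quotT => _ [pVE _]; rewrite pVE; split=> [[g ->]|[g _ <-]]; exists g.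
Qed.

Lemma exists_vertex_lift : exists r : Vb -> V, cancel r pV.
Proof. by have [/choice [r rK] _] := quotT; exists r. Qed.

Lemma pE_eq s t : pE s = pE t <-> gorbit s t \/ gorbit (opp s) t.
Proof.
case: quotT => _ [_ [_ pEE]]; rewrite pEE; split=> [[g [->|->]]|[|] [g _ <-]].
- by left; exists g.
- by right; exists g.
- by exists g; left.
- by exists g; right.
Qed.

Lemma pE_act g s : pE (act g s) = pE s.
Proof. by apply/esym/pE_eq; left; apply: gorbit_act. Qed.

Lemma pE_opp s : pE (opp s) = pE s.
Proof. by apply/esym/pE_eq; right; apply: gorbit_refl. Qed.

Lemma qjoins_edge s : qjoins pV pE (pE s) (pV (src s)) (pV (src (opp s))).
Proof. by exists s. Qed.

Variables (F : {set Eb}) (dir : Eb -> E).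
Hypothesis forestF : oriented_forest pV pE F dir.

Definition forest_out v s := [/\ src s = v, pE s \in F & gorbit (dir (pE s)) s].

Definition terminal v := forall s, ~ forest_out v s.

Lemma stab_forest_out v s : forest_out v s -> stab v `<=` stab s.
Proof.
move=> [<- sF [g _ gs]]; have [_ [_ [_ /(_ _ sF) dir_stab]]] := forestF.
rewrite -{}gs tree_src_equivariant !stab_act => h; apply: (dir_stab _).2.
Qed.

Lemma forest_out_act g v s : forest_out v s -> forest_out (act g v) (act g s).
Proof.
move=> [<- sF ds]; split; rewrite ?pE_act //; first exact: tree_src_equivariant.
exact: ginvariant_gorbit.
Qed.

Lemma forest_out_unique v s t : forest_out v s -> forest_out v t -> s = t.
Proof.
move=> out_s [tv tF dt]; have [sv sF ds] := out_s; have [_ [_ [dir_inj _]]] := forestF.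
have pV_dir u : gorbit (dir (pE u)) u -> pV (src (dir (pE u))) = pV (src u).
  by move=> du; apply/pV_eq/gorbit_src.
have pEst : pE s = pE t.
  by apply: dir_inj => //; rewrite -!/(src _) !pV_dir // sv tv.
have [g _ gst] : gorbit s t by apply: gorbit_trans dt; rewrite -pEst; apply: gorbit_sym.
rewrite -gst; symmetry; apply: (stab_forest_out out_s).
by rewrite /stab /= -{1}sv -tree_src_equivariant gst.
Qed.

Definition forest_step v : V :=
  if pselect (exists s, forest_out v s) is left ex_s then src (opp (sval (cid ex_s)))
  else v.

Lemma forest_step_out v s : forest_out v s -> forest_step v = src (opp s).
Proof.
rewrite /forest_step => out_s; case: pselect => [ex_s|[]]; last by exists s.
by case: cid => t out_t /=; rewrite (forest_out_unique out_t out_s).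
Qed.

Lemma forest_step_terminal v : terminal v -> forest_step v = v.
Proof.
rewrite /forest_step => term_v; case: pselect => // -[s out_s].
by case: (term_v s).
Qed.

Lemma terminal_act g v : terminal v -> terminal (act g v).
Proof.
move=> term_v s out_s; apply: (term_v (act g^-1%g s)).
by rewrite -(actK g v); apply: forest_out_act.
Qed.

Lemma forest_step_act g v : forest_step (act g v) = act g (forest_step v).
Proof.
have [[s out_s]|/forallNP term_v] := pselect (exists s, forest_out v s).
  rewrite (forest_step_out out_s) (forest_step_out (forest_out_act g out_s)).
  by rewrite tree_opp_equivariant tree_src_equivariant.
by rewrite !forest_step_terminal //; apply: terminal_act.
Qed.

Lemma forest_terminates v : exists n, terminal (iter n forest_step v).
Proof.
apply: contrapT => /forallNP no_end.
have /choice [s s_out] n : exists s, forest_out (iter n forest_step v) s.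
  by have /existsNP [s /contrapT] := no_end n; exists s.
have [acyc [_ _]] := forestF; apply: acyc.
apply: (@infinite_trail_has_cycle _ _ _ _ _ _ _ _ (fun n => pV (iter n forest_step v))
  (fun n => pE (s n))) => [n|n|n k snk].
- have [sn _ _] := s_out n; rewrite iterS (forest_step_out (s_out n)) -sn.
  exact: qjoins_edge.
- by case: (s_out n).
- have [sn _ dn] := s_out n; have [sk _ dk] := s_out k.
  rewrite -sn -sk; apply/pV_eq/gorbit_src.
  by apply: gorbit_trans dk; rewrite -snk; apply: gorbit_sym.
Qed.

Lemma iter_forest_step_act n g v :
  iter n forest_step (act g v) = act g (iter n forest_step v).
Proof. by elim: n => //= n ->; rewrite forest_step_act. Qed.

Lemma iter_forest_step_terminal n m v : terminal (iter n forest_step v) ->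
  terminal (iter m forest_step v) -> iter n forest_step v = iter m forest_step v.
Proof.
wlog nm : n m / (n <= m)%N => [wlog_nm term_n term_m|term_n _].
  by case: (leqP n m) => [|/ltnW] nm; [|symmetry]; apply: wlog_nm.
rewrite -(subnK nm) iterD; elim: (m - n)%N => //= k <-.
by rewrite forest_step_terminal.
Qed.

Definition forest_root v : V := iter (sval (cid (forest_terminates v))) forest_step v.

Lemma terminal_forest_root v : terminal (forest_root v).
Proof. by rewrite /forest_root; case: cid. Qed.

Lemma forest_root_iter n v : terminal (iter n forest_step v) ->
  forest_root v = iter n forest_step v.
Proof. exact/iter_forest_step_terminal/terminal_forest_root. Qed.

Lemma forest_root_terminal v : terminal v -> forest_root v = v.
Proof. exact: (@forest_root_iter 0%N). Qed.

Lemma forest_root_out v s : forest_out v s -> forest_root v = forest_root (src (opp s)).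
Proof.
move=> /forest_step_out <-; set n := sval (cid (forest_terminates (forest_step v))).
have iterE : forest_root (forest_step v) = iter n.+1 forest_step v by rewrite iterSr.
by rewrite iterE; apply: forest_root_iter; rewrite -iterE; apply: terminal_forest_root.
Qed.

Lemma forest_root_act g v : forest_root (act g v) = act g (forest_root v).
Proof.
rewrite (forest_root_iter (n := sval (cid (forest_terminates v)))).
  exact: iter_forest_step_act.
rewrite iter_forest_step_act.
exact/terminal_act/terminal_forest_root.
Qed.

Lemma forest_ind (P : V -> Prop) : (forall v, terminal v -> P v) ->
  (forall v s, forest_out v s -> P (src (opp s)) -> P v) -> forall v, P v.
Proof.
move=> P_term P_out v; have [n] := forest_terminates v.
elim: n v => [|n IH] v; first exact: P_term.
rewrite iterSr; have [[s out_s]|/forallNP term_v _] := pselect (exists s, forest_out v s).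
  by rewrite (forest_step_out out_s) => /IH; apply: P_out.
exact: P_term.
Qed.

Lemma sub_stab_forest_root v : stab v `<=` stab (forest_root v).
Proof. by move=> g gv; rewrite /stab /= -forest_root_act gv. Qed.

Lemma gorbit_forest_root v w : gorbit v w -> gorbit (forest_root v) (forest_root w).
Proof. by move=> [g _ <-]; rewrite forest_root_act; apply: gorbit_act. Qed.

Lemma forest_root_edge s : pE s \in F -> forest_root (src s) = forest_root (src (opp s)).
Proof.
move=> sF; have [_ [pE_dir _]] := forestF.
have /pE_eq [ds|dos] := pE_dir _ sF; first exact: forest_root_out.
symmetry; rewrite -{2}(tree_oppK s); apply: forest_root_out; split; rewrite ?pE_opp //.
exact: gorbit_oppl dos.
Qed.

Lemma qwalk_forest_root x es y v w : qwalk pV pE x es y -> {subset es <= F} ->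
  pV v = x -> pV w = y -> gorbit (forest_root v) (forest_root w).
Proof.
elim: es x v => [x v /= -> _ <- /esym/pV_eq|e es IH x v]; first exact: gorbit_forest_root.
move=> [z [[s [sE [sx sz]]] zy]] esF vx wy.
have sF : pE s \in F by rewrite sE esF // mem_head.
have vs : gorbit v (src s) by apply/pV_eq; rewrite vx.
apply: gorbit_trans (gorbit_forest_root vs) _; rewrite (forest_root_edge sF).
by apply: IH zy _ sz wy => f fes; rewrite esF // inE fes orbT.
Qed.

Lemma edge_ends_distinct s : pE s \in F -> pV (src (opp s)) <> pV (src s).
Proof.
move=> sF loop_s; have [acyc _] := forestF; apply: acyc.
exists (pV (src s)), [:: pE s]; split=> //; split=> //; split=> [e|].
  by rewrite inE => /eqP ->.
by exists (pV (src s)); split=> //; rewrite -{2}loop_s; apply: qjoins_edge.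
Qed.

End Forest.

Section Reroot.
Variables (G : Type) (grp : group_on G) (T : Gtree grp).
Variables (Vb Eb : finType) (pV : vtx T -> Vb) (pE : edg T -> Eb).
Hypothesis quotT : is_quotient pV pE.
Local Notation V := (tree_vert T).
Local Notation E := (tree_edge T).
Local Notation src := (@tree_src _ _ T).
Local Notation opp := (@tree_opp _ _ T).
Variable F : {set Eb}.
Implicit Types (v w : V) (s : E) (dir : Eb -> E).

Lemma oriented_forest_reverse dir s : oriented_forest pV pE F dir -> pE s \in F ->
  stab (src (opp s)) `<=` stab s -> gorbit (dir (pE s)) s ->
  (forall e, e \in F -> pV (src (dir e)) <> pV (src (opp s))) ->
  exists dir', oriented_forest pV pE F dir' /\
    forall e, e \in F -> pV (src (dir' e)) <> pV (src s).
Proof.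
move=> forestF sF tgt_s ds avoid; have [acyc [pE_dir [dir_inj dir_stab]]] := forestF.
exists (fun e => if e == pE s then opp s else dir e); split; last first.
  move=> e eF; case: eqP => [_|ne_s se]; first exact: (edge_ends_distinct forestF sF).
  apply: ne_s; apply: dir_inj => //; rewrite -/(src _) se; symmetry.
  exact/(pV_eq quotT)/gorbit_src.
split=> //; split; [|split].
- by move=> e eF; case: eqP => [->|_]; [apply: (pE_opp quotT)|apply: pE_dir].
- move=> e f eF fF; case: eqP => [->|_]; case: eqP => [->//|_].
  + by move/esym/(avoid _ fF).
  + by move/(avoid _ eF).
  + exact: dir_inj.
- move=> e eF g; case: eqP => [_|_]; last exact: dir_stab.
  split; first exact: (@sub_stab_src _ _ _ (opp s) g).
  by move=> /tgt_s; rewrite -stab_tree_opp; apply.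
Qed.

(* Reversing the edges on the path from [v] to its root makes [v] a root. *)
Lemma reroot dir (forestF : oriented_forest pV pE F dir) v :
  stab (forest_root quotT forestF v) `<=` stab v ->
  exists dir', oriented_forest pV pE F dir' /\
    forall e, e \in F -> pV (src (dir' e)) <> pV v.
Proof.
have [_ [pE_dir _]] := forestF.
elim/(forest_ind quotT forestF): v => [v term_v _|v s out_s IH rv].
  exists dir; split=> // e eF /(pV_eq quotT) [g _ gv].
  apply: (term_v (act g (dir e))); split; rewrite ?(pE_act quotT) ?pE_dir //.
    by rewrite -gv; apply: tree_src_equivariant.
  exact: gorbit_act.
have [<- sF ds] := out_s.
have tgt_s : stab (src (opp s)) `<=` stab s.
  apply: subset_trans (sub_stab_forest_root quotT forestF (v := src (opp s))) _.
  rewrite -(forest_root_out quotT forestF out_s).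
  exact: subset_trans rv (stab_forest_out forestF out_s).
have [|dir' [forestF' avoid]] := IH.
  rewrite -(forest_root_out quotT forestF out_s); apply: subset_trans rv _.
  apply: subset_trans (stab_forest_out forestF out_s) _.
  by rewrite -stab_tree_opp; apply: sub_stab_src.
apply: (oriented_forest_reverse forestF' sF tgt_s _ avoid).
have [_ [pE_dir' _]] := forestF'.
have /(pE_eq quotT) [//|d's] := pE_dir' _ sF; case: (avoid _ sF).
exact/(pV_eq quotT)/gorbit_src/gorbit_oppl.
Qed.

End Reroot.

Section MaximalForest.
Variables (G : Type) (grp : group_on G) (T : Gtree grp).
Variables (Vb Eb : finType) (pV : vtx T -> Vb) (pE : edg T -> Eb).
Hypothesis quotT : is_quotient pV pE.
Local Notation V := (tree_vert T).
Local Notation E := (tree_edge T).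
Local Notation src := (@tree_src _ _ T).
Local Notation opp := (@tree_opp _ _ T).
Variable F : {set Eb}.
Implicit Types (v w : V) (s t : E) (dir : Eb -> E).

Lemma oriented_forest_setU1 dir s : oriented_forest pV pE F dir ->
  stab (src s) `<=` stab s -> (forall e, e \in F -> pV (src (dir e)) <> pV (src s)) ->
  ~ has_cycle pV pE (pE s |: F) ->
  oriented_forest pV pE (pE s |: F) (fun e => if e == pE s then s else dir e).
Proof.
move=> [_ [pE_dir [dir_inj dir_stab]]] src_s avoid acyc.
have inF e : e \in pE s |: F -> e <> pE s -> e \in F by rewrite !inE => /orP [/eqP|].
split=> //; split; [|split].
- by move=> e eF; case: eqP => [->//|ne]; apply/pE_dir/inF.
- move=> e f eF fF; case: eqP => [->|ne]; case: eqP => [->//|nf].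
  + by move/esym/(avoid _ (inF _ fF nf)).
  + by move/(avoid _ (inF _ eF ne)).
  + by apply: dir_inj; apply: inF.
- move=> e eF g; case: eqP => [_|ne]; last exact/dir_stab/inF.
  by split; [apply: (@sub_stab_src _ _ _ s g)|apply: src_s].
Qed.

Variable dir : Eb -> E.
Hypothesis forestF : oriented_forest pV pE F dir.
Local Notation root := (forest_root quotT forestF).

Lemma qjoins_forest_root s x y : qjoins pV pE (pE s) x y ->
  (forall v w, pV v = x -> pV w = y -> gorbit (root v) (root w)) ->
  gorbit (root (src s)) (root (src (opp s))).
Proof.
move=> [t [ts [tx ty]]] root_xy; have t_orb := root_xy (src t) (src (opp t)) tx ty.
have root_src s' t' : gorbit s' t' -> gorbit (root (src s')) (root (src t')).
  by move/gorbit_src/(gorbit_forest_root quotT forestF).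
have /(pE_eq quotT) [st|st] := esym ts.
  apply: gorbit_trans (root_src _ _ st) (gorbit_trans t_orb _).
  exact/gorbit_sym/root_src/gorbit_opp.
apply: gorbit_trans (gorbit_trans (gorbit_sym t_orb) _); last exact/gorbit_sym/root_src.
exact/root_src/gorbit_oppl.
Qed.

Hypothesis maxF : forall F' : {set Eb}, F \proper F' ->
  ~ exists dir, oriented_forest pV pE F' dir.

(* Otherwise the forest could be enlarged by [pE s], after rerooting. *)
Lemma maximal_forest_gorbit s : stab (root (src s)) `<=` stab s ->
  gorbit (root (src s)) (root (src (opp s))).
Proof.
move=> root_s; have [/(forest_root_edge quotT forestF) <-|nsF] := boolP (pE s \in F).
  exact: gorbit_refl.
apply: contrapT => no.
have [dir' [forestF' avoid]] := reroot (subset_trans root_s (@sub_stab_src _ _ _ s)).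
apply: (maxF (F' := pE s |: F)).
  by apply/properP; split; [exact: finset.subsetUr|exists (pE s); rewrite ?inE ?eqxx].
exists (fun e => if e == pE s then s else dir' e); apply: oriented_forest_setU1 => //.
  exact: subset_trans (sub_stab_forest_root _ _ (v := src s)) root_s.
move=> /has_cycle_setU1 [|[x [y [es [xy yx esF]]]]]; first by case: forestF.
apply/no/(qjoins_forest_root xy) => v w vx wy.
exact/gorbit_sym/(qwalk_forest_root quotT forestF yx esF).
Qed.

Lemma flows_forest_root (N : set V) v : (forall s, finite_set (stab s)) ->
  @flows _ (tree_graph T) N v -> stab (root v) `<=` stab v ->
  exists w, [/\ ~ N w, gorbit (root v) (root w) &
    weight (stab w) = weight (stab (root v))].
Proof.
move=> finE; have sub_root w : stab w `<=` stab (root w) by apply: sub_stab_forest_root.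
elim=> {v} [v nv|b e be _ IH] rv.
  exists v; split=> //; first exact: gorbit_refl.
  by congr weight; apply/seteqP; split.
set s := dart_edge (b, e); have se : stab s = stab e := stab_dart_edge _.
rewrite -[ends b e]/(src s) -se in be rv *.
rewrite (_ : ends (~~ b) e = src (opp s)) in IH; last by rewrite -dart_edge_opp.
have root_s : stab (root (src s)) `<=` stab s := subset_trans rv be.
have orb := maximal_forest_gorbit root_s.
have s_root : stab s `<=` stab (root (src (opp s))).
  by rewrite -stab_tree_opp; apply: subset_trans (sub_root _); apply: sub_stab_src.
have rootE : stab (root (src s)) = stab (root (src (opp s))).
  apply: weight_le_eq_subgroup; try exact: subgroup_stab.
  - exact: subset_trans root_s s_root.
  - exact: sub_finite_set root_s (finE s).
  - by rewrite (weight_stab_gorbit orb).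
have [|w [nw ow we]] := IH.
  rewrite -rootE; apply: subset_trans root_s _.
  by rewrite -stab_tree_opp; apply: sub_stab_src.
by exists w; split; [|apply: gorbit_trans orb ow|rewrite we rootE].
Qed.

End MaximalForest.

Section ForestSum.
Variables (G : Type) (grp : group_on G) (T : Gtree grp).
Variables (Vb Eb : finType) (pV : vtx T -> Vb) (pE : edg T -> Eb).
Hypothesis quotT : is_quotient pV pE.
Local Notation V := (tree_vert T).
Local Notation src := (@tree_src _ _ T).
Variable c : Eb -> nat.
Hypothesis cardE : forall et : edg T, has_card (stabE et) (c (pE et)).

Lemma card_stab_edge (s : tree_edge T) : (stab s #= `I_(c (pE s)))%card.
Proof. exact: (has_card_card_eq (T := group_carrier grp) (cardE s)). Qed.

Lemma finite_stab_edge (s : tree_edge T) : finite_set (stab s).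
Proof. by apply/finite_setP; exists (c (pE s)); apply: card_stab_edge. Qed.

Lemma weight_stab_edge (s : tree_edge T) : weight (stab s) = (c (pE s))%:R^-1.
Proof. by rewrite /weight (card_fset_set (card_stab_edge s)). Qed.

Lemma arc_sum_tree_graph : arc_sum (tree_graph T) = \sum_e (c e)%:R^-1.
Proof.
have [_ [_ [pE_onto _]]] := quotT.
have /choice [r rE] e : exists s : positive_edge T, pE (val s) = e.
  have [s <-] := pE_onto e; have [ps|nps] := boolP (positive s).
    by exists (exist _ s ps).
  have ps : positive (tree_opp s) by rewrite positive_opp.
  by exists (exist _ (tree_opp s) ps); rewrite /= (pE_opp quotT).
pose pE_pos (s : positive_edge T) := pE (val s).
rewrite /arc_sum (orbit_sum_finquotient (pi := pE_pos) (r := r)) //.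
  apply: eq_big => [e|e _]; first exact: asboolT.
  by rewrite -(stab_dart_edge (true, r e)) weight_stab_edge /dart_edge rE.
move=> s t; rewrite /pE_pos (pE_eq quotT).
split=> [[|] [g _ gst]|[g _ <-]]; last by left; exists g.
  by exists g => //; apply: val_inj.
by have := valP t; rewrite -gst positive_act positive_opp (valP s).
Qed.

Section Roots.
Variables (F : {set Eb}) (dir : Eb -> tree_edge T) (N : set V).
Hypothesis forestF : oriented_forest pV pE F dir.
Hypothesis maxF : forall F' : {set Eb}, F \proper F' ->
  ~ exists dir, oriented_forest pV pE F' dir.
Hypotheses (iN : ginvariant N) (flN : forall v, @flows _ (tree_graph T) N v).
Variable r : Vb -> V.
Hypothesis rK : cancel r pV.

Definition forest_tails : {set Vb} := [set pV (src (dir e)) | e in F]%SET.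

Lemma sum_forest_tails :
  \sum_(e in F) (c e)%:R^-1 = \sum_(x in forest_tails) weight (stab (r x)).
Proof.
have [_ [pE_dir [dir_inj dir_stab]]] := forestF.
rewrite big_imset /=; last by move=> e f eF fF; apply: dir_inj.
apply: eq_bigr => e eF; have r_dir : gorbit (r (pV (src (dir e)))) (src (dir e)).
  by apply/(pV_eq quotT); rewrite rK.
rewrite -(weight_stab_gorbit r_dir) -{1}(pE_dir e eF) -weight_stab_edge; congr weight.
by apply/seteqP; split=> g /(dir_stab _ eF).
Qed.

Lemma terminal_notin_tails x : x \notin forest_tails -> terminal pE F dir (r x).
Proof.
move=> xF s [sx sF [g _ gs]]; case/negP: xF; apply/imsetP; exists (pE s) => //.
rewrite -[LHS]rK; apply/(pV_eq quotT)/gorbit_sym; exists g => //.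
by rewrite -tree_src_equivariant gs.
Qed.

Lemma sum_notin_tails_le :
  \sum_(x | x \notin forest_tails) weight (stab (r x)) <=
  \sum_(x | ~~ `[< N (r x) >]) weight (stab (r x)).
Proof.
have /choice [z zP] x : exists w, x \notin forest_tails ->
    [/\ ~ N w, gorbit (r x) (forest_root quotT forestF w) &
      weight (stab w) = weight (stab (r x))].
  have [_|xF] := boolP (x \in forest_tails); first by exists (r x).
  have root_x := forest_root_terminal quotT forestF (terminal_notin_tails xF).
  have [|w] := flows_forest_root (quotT := quotT) (forestF := forestF) maxF
    finite_stab_edge (flN (r x)); first by rewrite root_x.
  by rewrite root_x => wP; exists w.
have r_z x : gorbit (z x) (r (pV (z x))) by apply/(pV_eq quotT); rewrite rK.
apply: (ler_sum_inj (h := pV \o z)) => [x y xF yF|x xF|x _]; last exact: weight_ge0.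
  have [_ xz _] := zP x xF; have [_ yz _] := zP y yF.
  move=> /(pV_eq quotT) /(gorbit_forest_root quotT forestF) zz.
  rewrite -[x]rK -[y]rK; apply/(pV_eq quotT).
  exact: gorbit_trans xz (gorbit_trans zz (gorbit_sym yz)).
have [nN _ wz] := zP x xF; split; last by rewrite (weight_stab_gorbit (r_z x)).
by apply/asboolPn; have [g _ <-] := r_z x; rewrite ginvariantE.
Qed.

End Roots.

Lemma maximal_forest_sum_le (F : {set Eb}) (N : set V) :
  compressing_forest pV pE F -> ginvariant N ->
  (forall v, @flows _ (tree_graph T) N v) ->
  \sum_(e | e \notin F) (c e)%:R^-1 <= arc_sum (tree_graph T) - orbit_sum N.
Proof.
move=> [[dir forestF] maxF] iN flN.
have [r rK] := exists_vertex_lift quotT.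
rewrite arc_sum_tree_graph (orbit_sum_finquotient (pV_eq quotT) rK iN).
have split_sum (I : finType) (P : pred I) (f : I -> rat) :
  \sum_i f i = \sum_(i | P i) f i + \sum_(i | ~~ P i) f i by apply: bigID.
have tails_le := sum_notin_tails_le forestF maxF iN flN rK.
have := split_sum _ (mem (forest_tails F dir)) (fun x => weight (stab (r x))).
rewrite (split_sum _ (fun x => `[< N (r x) >])) (split_sum _ (mem F)) /=.
by rewrite (sum_forest_tails forestF rK); lra.
Qed.

End ForestSum.

Theorem theorem2p3 (G : Type) (grp : group_on G) (d : nat)
  (Hd : min_num_generators grp d)
  (T : Gtree grp) (Vb Eb : finType) (pV : vtx T -> Vb) (pE : edg T -> Eb)
  (HQ : is_quotient pV pE)
  (c : Eb -> nat) (Hc : forall et : edg T, has_card (stabE et) (c (pE et)))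
  (F : {set Eb}) (HF : compressing_forest pV pE F) :
  (\sum_(e : Eb | e \notin F) ((c e)%:R : rat)^-1 <= d%:R)%R.
Proof.
have [[hs [<- gen]] _] := Hd; have [r rK] := exists_vertex_lift HQ.
have leE (s : arc (tree_graph T)) : (stab s #<= `I_(\max_e c e))%card.
  rewrite -(stab_dart_edge (true, s)) (card_le_eql (card_stab_edge Hc _)) card_le_II.
  exact: leq_bigmax.
have reps (v : vert (tree_graph T)) : exists2 w, w \in [seq r x | x : Vb] & gorbit w v.
  by exists (r (pV v)); [exact: codom_f|apply/(pV_eq HQ); rewrite rK].
have [N [iN flN excess_le]] :=
  tree_rooting (gtree_tree_graph T) leE (generates_generating gen) reps.
exact: le_trans (maximal_forest_sum_le HQ Hc HF iN flN) excess_le.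
Qed.
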